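(* Let $p\ne1/2$ and $c(p)=\big|\log\frac{1-p}{p}\big|^{-1}$. For every $\epsilon>0$, as $t\to\infty$, $$\mathbb{P}_p\Big((1-\epsilon)c(p)\log t\le\max_{s\in(0,t)}M_s\le\max_{s\in(0,t)}D_s\le(1+\epsilon)c(p)\log t\ \Big|\ X_t=O\Big)\to1.$$
   Context: The simple exclusion process on $\mathbb{Z}$ with parameter $p\in(0,1)$: each site is occupied by at most one particle; each particle attempts to jump one site to the right at rate $p$ and one site to the left at rate $1-p$, an attempt succeeding iff the target site is empty. $O$ is the configuration with every negative site occupied and every non-negative site empty. $\mathbb{P}_p$ is the law of the process started from $O$, $X_t$ the state at time $t$. For a configuration $x$ reachable from $O$, $D(x)$ is the minimal number of jumps needed to go from $O$ to $x$ (equivalently the sum over $k\ge1$ of the displacement of the $k$-th rightmost particle from its initial position $-k$), and $M(x)$ is the position of the rightmost particle of $x$. $D_t=D(X_t)$, $M_t=M(X_t)$. *)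

(* Defs.v *)
From Stdlib Require Import Reals ZArith List Lia.
From Stdlib Require Import ClassicalDescription ClassicalEpsilon.
From Coquelicot Require Import Coquelicot.
Open Scope R_scope.

(** Configurations of the exclusion process on Z: true = occupied. *)
Definition conf := Z -> bool.

Definition Oconf : conf := fun z => Z.ltb z 0.

(** Exchange of the contents of sites i and i+1 (edge i). When exactly one
    of the two sites is occupied this is a jump of a particle across edge i. *)
Definition swap (x : conf) (i : Z) : conf :=
  fun z => if Z.eqb z i then x (i + 1)%Z
           else if Z.eqb z (i + 1)%Z then x i else x z.

Definition rate (p : R) (x : conf) (i : Z) : R :=
  if andb (x i) (negb (x (i + 1)%Z)) then p
  else if andb (negb (x i)) (x (i + 1)%Z) then 1 - p else 0.

Definition zenum (k : nat) : Z :=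
  if Nat.even k then Z.of_nat (k / 2) else (- Z.of_nat (S k / 2))%Z.

(** Total jump rate out of x (a series with finitely many non-zero terms
    for configurations reachable from O). *)
Definition qout (p : R) (x : conf) : R := Series (fun k => rate p x (zenum k)).

Definition ind (P : Prop) : R :=
  if excluded_middle_informative P then 1 else 0.

(** [G p Ev n hist x t]: for the chain currently at [x], having previously
    visited the states [hist] (most recent first), the probability that in the
    remaining time [t] it makes exactly [n] more jumps and that the whole list
    of visited states (in chronological order) satisfies [Ev].
    First-jump decomposition of the continuous-time Markov chain: the first
    jump, across edge i, happens at time s with density
    rate x i * exp (- qout x * s). *)
Fixpoint G (p : R) (Ev : list conf -> Prop) (n : nat) (hist : list conf)
         (x : conf) (t : R) : R :=
  match n with
  | O => ind (Ev (rev (x :: hist))) * exp (- qout p x * t)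
  | S n' => Series (fun k =>
      RInt (fun s => rate p x (zenum k) * exp (- qout p x * s)
                     * G p Ev n' (x :: hist) (swap x (zenum k)) (t - s)) 0 t)
  end.

Definition Prob (p : R) (Ev : list conf -> Prop) (t : R) : R :=
  Series (fun n => G p Ev n nil Oconf t).

Inductive reach : nat -> conf -> Prop :=
| reach0 : reach 0 Oconf
| reachS : forall n x i, reach n x -> x i <> x (i + 1)%Z -> reach (S n) (swap x i).

Definition Dnum (x : conf) : nat :=
  epsilon (inhabits 0%nat) (fun n => reach n x /\ forall m, reach m x -> (n <= m)%nat).

Definition Mpos (x : conf) : Z :=
  epsilon (inhabits 0%Z) (fun z => x z = true /\ forall w, x w = true -> (w <= z)%Z).

Definition lmax (f : conf -> R) (xs : list conf) : R :=
  fold_right (fun x m => Rmax (f x) m) (f (hd Oconf xs)) xs.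

Definition EvO (xs : list conf) : Prop := last xs Oconf = Oconf.

Definition cp (p : R) : R := / Rabs (ln ((1 - p) / p)).

Definition EvGood (p eps t : R) (xs : list conf) : Prop :=
  EvO xs /\
  (1 - eps) * cp p * ln t <= lmax (fun x => IZR (Mpos x)) xs /\
  lmax (fun x => IZR (Mpos x)) xs <= lmax (fun x => INR (Dnum x)) xs /\
  lmax (fun x => INR (Dnum x)) xs <= (1 + eps) * cp p * ln t.

(* Main.v *)
From Stdlib Require Import Reals ZArith List Lia Lra Permutation.
From Stdlib Require Import ClassicalEpsilon FunctionalExtensionality Classical.
From Coquelicot Require Import Coquelicot.
Require Import Defs.
Open Scope R_scope.
Import List ListNotations.

(** Reflecting [p] into [1 - p] multiplies the probability of every event contained in
    [X_t = O] by [exp (- (2 p - 1) t)], because the numbers of possible right and left jumps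
    always differ by one; so one may assume [p < 1/2] and put [r = p / (1 - p) < 1]. The chain is
    then reversible with respect to [r ^ D x], and the sum of [r ^ D x] over all configurations is
    at most the product over [z] of [1 + r ^ |z|], which is finite.

    Upper bound: stationarity of [r ^ D] on [D < m] shows that the probability of reaching
    [D >= m] before time [t] is at most [t] times the flux through the level [m], that is
    [t r ^ (m (1 - o(1)))].

    Lower bound: the position of the rightmost particle dominates a biased walk; a function of
    the mean exit times of this walk is a supersolution of the backward equation, so the
    probability that the rightmost particle stays below [y] is at most [exp (- C r ^ y t)].

    Conditioning: with [U s x] the probability to be at [O] at time [s] without reaching
    [D >= m] from [x], reversibility gives [U (2 s) O = <U s, U s> >= <U s, 1> ^ 2 / <1, 1>], and
    [<U s, 1>] is close to 1 since mass only leaks through the level [m]. Hence [P (X_t = O)] is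
    bounded below.

    All estimates are comparison arguments for the differential equations satisfied by [G]. *)

(** * Finite sums over lists *)

Definition lsum {A : Type} (l : list A) (f : A -> R) : R :=
  fold_right (fun a s => f a + s) 0 l.

Lemma lsum_ext {A} (l : list A) f g :
  (forall a, In a l -> f a = g a) -> lsum l f = lsum l g.
Proof.
  induction l as [|a l IH]; intros H; simpl; auto.
  rewrite (H a) by (left; auto). rewrite IH; auto. intros; apply H; right; auto.
Qed.

Lemma lsum_le {A} (l : list A) f g :
  (forall a, In a l -> f a <= g a) -> lsum l f <= lsum l g.
Proof.
  induction l as [|a l IH]; intros H; simpl; [lra|].
  apply Rplus_le_compat; [apply H; left; auto|apply IH; intros; apply H; right; auto].
Qed.

Lemma lsum_zero {A} (l : list A) f : (forall a, In a l -> f a = 0) -> lsum l f = 0.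
Proof.
  induction l as [|a l IH]; intros H; simpl; auto.
  rewrite (H a), IH by (try (left; reflexivity); intros; apply H; right; auto). lra.
Qed.

Lemma lsum_nonneg {A} (l : list A) f :
  (forall a, In a l -> 0 <= f a) -> 0 <= lsum l f.
Proof.
  intros H. rewrite <- (lsum_zero l (fun _ => 0)) by auto. apply lsum_le; auto.
Qed.

Lemma lsum_plus {A} (l : list A) f g :
  lsum l (fun a => f a + g a) = lsum l f + lsum l g.
Proof. induction l as [|a l IH]; simpl; [lra|rewrite IH; lra]. Qed.

Lemma lsum_minus {A} (l : list A) f g :
  lsum l (fun a => f a - g a) = lsum l f - lsum l g.
Proof. induction l as [|a l IH]; simpl; [lra|rewrite IH; lra]. Qed.

Lemma lsum_scal {A} (l : list A) c f : lsum l (fun a => c * f a) = c * lsum l f.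
Proof. induction l as [|a l IH]; simpl; [lra|rewrite IH; lra]. Qed.

Lemma lsum_const {A} (l : list A) c : lsum l (fun _ => c) = INR (length l) * c.
Proof.
  induction l as [|a l IH]; cbn [length lsum fold_right]; [simpl; lra|].
  fold (lsum l (fun _ : A => c)). rewrite IH, S_INR. lra.
Qed.

Lemma lsum_app {A} (l l' : list A) f : lsum (l ++ l') f = lsum l f + lsum l' f.
Proof. induction l as [|a l IH]; simpl; [lra|rewrite IH; lra]. Qed.

Lemma lsum_map {A B} (h : B -> A) (l : list B) f :
  lsum (map h l) f = lsum l (fun b => f (h b)).
Proof. induction l as [|a l IH]; simpl; [lra|rewrite IH; lra]. Qed.

Lemma lsum_perm {A} (l l' : list A) f : Permutation l l' -> lsum l f = lsum l' f.
Proof. induction 1; simpl; lra. Qed.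

Lemma lsum_exchange {A B} (l : list A) (l' : list B) f :
  lsum l (fun a => lsum l' (f a)) = lsum l' (fun b => lsum l (fun a => f a b)).
Proof.
  induction l as [|a l IH]; simpl.
  - symmetry; apply lsum_zero; auto.
  - rewrite IH, lsum_plus. reflexivity.
Qed.

Lemma lsum_ge_term {A} (l : list A) f a :
  (forall b, In b l -> 0 <= f b) -> In a l -> f a <= lsum l f.
Proof.
  induction l as [|b l IH]; intros H Hi; [destruct Hi|destruct Hi as [<-|Hi]]; simpl.
  - assert (0 <= lsum l f) by (apply lsum_nonneg; intros; apply H; right; auto). lra.
  - assert (0 <= f b) by (apply H; left; auto).
    assert (f a <= lsum l f) by (apply IH; auto; intros; apply H; right; auto). lra.
Qed.

(** * Configurations *)

Definition zsum (l : list Z) (f : Z -> Z) : Z :=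
  fold_right (fun a s => (f a + s)%Z) 0%Z l.

Lemma zsum_ext l f g : (forall a, In a l -> f a = g a) -> zsum l f = zsum l g.
Proof.
  induction l as [|a l IH]; intros H; simpl; auto.
  rewrite (H a) by (left; auto). rewrite IH; auto. intros; apply H; right; auto.
Qed.

Lemma zsum_plus l f g : zsum l (fun a => (f a + g a)%Z) = (zsum l f + zsum l g)%Z.
Proof. induction l as [|a l IH]; simpl; [lia|rewrite IH; lia]. Qed.

Lemma zsum_app l l' f : zsum (l ++ l') f = (zsum l f + zsum l' f)%Z.
Proof. induction l as [|a l IH]; simpl; [lia|rewrite IH; lia]. Qed.

Lemma zsum_nonneg l f : (forall a, In a l -> 0 <= f a)%Z -> (0 <= zsum l f)%Z.
Proof.
  induction l as [|a l IH]; intros H; simpl; [lia|].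
  assert (0 <= f a)%Z by (apply H; left; auto).
  assert (0 <= zsum l f)%Z by (apply IH; intros; apply H; right; auto). lia.
Qed.

Lemma zsum_ge_term l f a :
  (forall b, In b l -> 0 <= f b)%Z -> In a l -> (f a <= zsum l f)%Z.
Proof.
  induction l as [|b l IH]; intros H Hi; [destruct Hi|destruct Hi as [<-|Hi]]; simpl.
  - assert (0 <= zsum l f)%Z by (apply zsum_nonneg; intros; apply H; right; auto). lia.
  - assert (0 <= f b)%Z by (apply H; left; auto).
    assert (f a <= zsum l f)%Z by (apply IH; auto; intros; apply H; right; auto). lia.
Qed.

Lemma zsum_delta l i c : NoDup l -> In i l ->
  zsum l (fun z => if Z.eqb z i then c else 0%Z) = c.
Proof.
  induction 1 as [|a l Ha Hl IH]; intros Hi; [destruct Hi|]. simpl.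
  destruct Hi as [->|Hi].
  - rewrite Z.eqb_refl.
    rewrite (zsum_ext l _ (fun _ => 0%Z)).
    + assert (forall l', zsum l' (fun _ => 0%Z) = 0%Z) as ->; [|lia].
      induction l' as [|b l' IH']; simpl; auto.
    + intros b Hb. destruct (Z.eqb_spec b i); subst; tauto.
  - rewrite IH by auto. destruct (Z.eqb_spec a i); subst; [tauto|lia].
Qed.

(** * Symmetric windows of sites, and series over edges *)

Fixpoint sites (w : nat) : list Z :=
  match w with
  | O => []
  | S w' => sites w' ++ [Z.of_nat w'; (- Z.of_nat w' - 1)%Z]
  end.

Lemma In_sites w z : In z (sites w) <-> (- Z.of_nat w <= z < Z.of_nat w)%Z.
Proof.
  induction w as [|w IH]; [simpl; lia|].
  cbn [sites]. rewrite in_app_iff, IH. cbn [In]. lia.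
Qed.

Lemma NoDup_sites w : NoDup (sites w).
Proof.
  induction w as [|w IH]; [constructor|]. cbn [sites].
  apply NoDup_app; auto.
  - constructor; [simpl; lia|]. constructor; [simpl; tauto|constructor].
  - intros z Hz. apply In_sites in Hz. simpl. lia.
Qed.

Lemma length_sites w : length (sites w) = (2 * w)%nat.
Proof.
  induction w as [|w IH]; [auto|]. cbn [sites]. rewrite length_app, IH. simpl. lia.
Qed.

Lemma zenum_even w : zenum (2 * w) = Z.of_nat w.
Proof.
  unfold zenum. rewrite Nat.even_mul. simpl Nat.even.
  replace (2 * w)%nat with (w * 2)%nat by lia. rewrite Nat.div_mul by lia. auto.
Qed.

Lemma zenum_odd w : zenum (S (2 * w)) = (- Z.of_nat w - 1)%Z.
Proof.
  unfold zenum. rewrite Nat.even_succ, Nat.odd_mul. change (Nat.odd 2) with false.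
  cbn [andb].
  replace (S (S (2 * w)))%nat with ((S w) * 2)%nat by lia. rewrite Nat.div_mul by lia. lia.
Qed.

(** Both lists run through 0, -1, 1, -2, ..., so a window is an initial segment of the series over
    edges that occur in [qout] and [G]. *)
Lemma map_zenum_seq w : map zenum (seq 0 (2 * w)) = sites w.
Proof.
  induction w as [|w IH]; auto. cbn [sites].
  replace (2 * S w)%nat with (2 * w + 2)%nat by lia.
  rewrite seq_app, map_app, IH. cbn [seq map].
  rewrite Nat.add_0_l, zenum_even, zenum_odd. reflexivity.
Qed.

Lemma zenum_large w k : (2 * w <= k)%nat ->
  (zenum k < - Z.of_nat w \/ Z.of_nat w <= zenum k)%Z.
Proof.
  intros H. destruct (Nat.Even_or_Odd k) as [[j ->]|[j ->]].
  - rewrite zenum_even. lia.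
  - rewrite Nat.add_1_r, zenum_odd. lia.
Qed.

Lemma sum_n_lsum (f : nat -> R) n : sum_n f n = lsum (seq 0 (S n)) f.
Proof.
  induction n as [|n IH].
  - rewrite sum_O. simpl. lra.
  - rewrite sum_Sn, IH. rewrite (seq_S (S n)), lsum_app. unfold plus; simpl. lra.
Qed.

Lemma is_series_finite_support (f : nat -> R) n :
  (forall k, (n <= k)%nat -> f k = 0) -> is_series f (lsum (seq 0 n) f).
Proof.
  intros H. change (is_lim_seq (sum_n f) (lsum (seq 0 n) f)).
  apply is_lim_seq_ext_loc with (fun _ => lsum (seq 0 n) f).
  2: apply is_lim_seq_const.
  exists n. intros k Hk. rewrite sum_n_lsum.
  replace (S k) with (n + (S k - n))%nat by lia. rewrite seq_app, lsum_app.
  rewrite (lsum_zero (seq (0 + n) _)); [lra|].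
  intros a Ha. apply in_seq in Ha. apply H. lia.
Qed.

Lemma Series_sites (f : Z -> R) w :
  (forall z, (z < - Z.of_nat w \/ Z.of_nat w <= z)%Z -> f z = 0) ->
  Series (fun k => f (zenum k)) = lsum (sites w) f.
Proof.
  intros H. rewrite <- map_zenum_seq, lsum_map.
  apply is_series_unique, is_series_finite_support.
  intros k Hk. apply H, zenum_large; auto.
Qed.

(** * Configurations that differ from [Oconf] at finitely many sites *)

Definition dev (x : conf) (z : Z) : Z := (Z.b2z (x z) - Z.b2z (Oconf z))%Z.

Definition win (w : nat) (x : conf) : Prop :=
  forall z, (z < - Z.of_nat w \/ Z.of_nat w <= z)%Z -> x z = Oconf z.

Definition fin (x : conf) : Prop := exists w, win w x.

Lemma win_weaken w w' x : (w <= w')%nat -> win w x -> win w' x.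
Proof. intros H Hx z Hz. apply Hx. lia. Qed.

Lemma win_O w : win w Oconf.
Proof. intros z _; auto. Qed.

Lemma dev_win w x z : win w x -> (z < - Z.of_nat w \/ Z.of_nat w <= z)%Z -> dev x z = 0%Z.
Proof. intros H Hz. unfold dev. rewrite H by auto. lia. Qed.

Lemma swap_l x i : swap x i i = x (i + 1)%Z.
Proof. unfold swap. rewrite Z.eqb_refl. auto. Qed.

Lemma swap_r x i : swap x i (i + 1)%Z = x i.
Proof. unfold swap. destruct (Z.eqb_spec (i+1) i); [lia|]. rewrite Z.eqb_refl. auto. Qed.

Lemma swap_other x i z : z <> i -> z <> (i + 1)%Z -> swap x i z = x z.
Proof.
  intros. unfold swap. destruct (Z.eqb_spec z i); [tauto|].
  destruct (Z.eqb_spec z (i+1)); tauto.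
Qed.

Lemma swap_swap x i : swap (swap x i) i = x.
Proof.
  apply functional_extensionality; intros z.
  destruct (Z.eq_dec z i) as [->|]; [rewrite swap_l; apply swap_r|].
  destruct (Z.eq_dec z (i + 1)) as [->|]; [rewrite swap_r; apply swap_l|].
  rewrite !swap_other by auto. auto.
Qed.

Lemma win_swap_inside w x i : win w x ->
  (- Z.of_nat w <= i)%Z -> (i + 1 < Z.of_nat w)%Z -> win w (swap x i).
Proof. intros H H1 H2 z Hz. rewrite swap_other by lia. apply H; auto. Qed.

Lemma win_swap w x i : win w x -> exists w', (w <= w')%nat /\ win w' x /\ win w' (swap x i) /\
  In i (sites w') /\ In (i + 1)%Z (sites w').
Proof.
  intros H. exists (w + Z.to_nat (Z.abs i) + 2)%nat.
  assert (Hx : win (w + Z.to_nat (Z.abs i) + 2) x) by (apply win_weaken with w; auto; lia).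
  rewrite !In_sites. repeat split; auto; try lia.
  apply win_swap_inside; auto; lia.
Qed.

Lemma fin_swap x i : fin x -> fin (swap x i).
Proof. intros [w H]. destruct (win_swap w x i H) as (w' & _ & _ & H' & _). exists w'; auto. Qed.

Lemma zsum_win c w w' x : win w x -> (w <= w')%nat ->
  zsum (sites w') (fun z => (c z * dev x z)%Z) = zsum (sites w) (fun z => (c z * dev x z)%Z).
Proof.
  intros H. induction 1 as [|w' Hw IH]; auto. cbn [sites]. rewrite zsum_app, IH.
  cbn [zsum fold_right]. rewrite !(dev_win w x) by (auto; lia). lia.
Qed.

Lemma zsum_win_eq c w w' x : win w x -> win w' x ->
  zsum (sites w') (fun z => (c z * dev x z)%Z) = zsum (sites w) (fun z => (c z * dev x z)%Z).
Proof.
  intros H H'. destruct (Nat.le_ge_cases w w').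
  - apply zsum_win; auto.
  - symmetry; apply zsum_win; auto.
Qed.

(** Only the terms at [i] and [i + 1] change. The weight [c] is left general: [c z = z] gives the
    change of [area], and [c z = 1] the conservation of the number of particles. *)
Lemma zsum_swap c l x i : NoDup l -> In i l -> In (i + 1)%Z l ->
  zsum l (fun z => (c z * dev (swap x i) z)%Z) =
  (zsum l (fun z => (c z * dev x z)%Z)
   + (c (i + 1)%Z - c i) * (Z.b2z (x i) - Z.b2z (x (i + 1)%Z)))%Z.
Proof.
  intros Hl Hi Hi'. set (d := (Z.b2z (x i) - Z.b2z (x (i + 1)%Z))%Z).
  rewrite (zsum_ext l _ (fun z => ((c z * dev x z + (if Z.eqb z i then - c i * d else 0))
     + (if Z.eqb z (i + 1) then c (i + 1)%Z * d else 0))%Z)).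
  - rewrite !zsum_plus, !zsum_delta by auto. ring.
  - intros z _. unfold dev, swap.
    destruct (Z.eqb_spec z i); destruct (Z.eqb_spec z (i + 1)); subst; unfold d; try lia; ring.
Qed.

(** An arbitrary admissible window; by [area_win] the choice does not affect [area]. *)
Definition width (x : conf) : nat := epsilon (inhabits 0%nat) (fun w => win w x).

(** Total displacement of the particles of [x] from [Oconf]; unlike [Dnum] it is
    also meaningful for configurations with a different number of particles. *)
Definition area (x : conf) : nat :=
  Z.to_nat (zsum (sites (width x)) (fun z => (z * dev x z)%Z)).

(** A particle at [z >= 0] has deviation 1 and a hole at [z < 0] has deviation -1, so the area is a
    sum of nonnegative costs of single sites. *)
Lemma dev_term_abs x z : x z <> Oconf z -> (z * dev x z)%Z = Z.abs z.
Proof.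
  unfold dev, Oconf. destruct (x z); destruct (Z.ltb_spec z 0); simpl; intros; try tauto; lia.
Qed.

Lemma dev_term_nonneg x z : (0 <= z * dev x z)%Z.
Proof.
  unfold dev, Oconf. destruct (x z); destruct (Z.ltb_spec z 0); simpl; lia.
Qed.

Lemma area_win w x : win w x -> Z.of_nat (area x) = zsum (sites w) (fun z => (z * dev x z)%Z).
Proof.
  intros H. unfold area. rewrite Z2Nat.id.
  - apply (zsum_win_eq (fun z => z)); auto. unfold width. apply epsilon_spec. exists w; auto.
  - apply zsum_nonneg. intros; apply dev_term_nonneg.
Qed.

Lemma area_O : area Oconf = 0%nat.
Proof. apply Nat2Z.inj. rewrite (area_win 0) by apply win_O. reflexivity. Qed.

Lemma area_swap x i : fin x ->
  Z.of_nat (area (swap x i)) = (Z.of_nat (area x) + (Z.b2z (x i) - Z.b2z (x (i + 1)%Z)))%Z.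
Proof.
  intros [w H]. destruct (win_swap w x i H) as (w' & _ & H1 & H2 & H3 & H4).
  rewrite (area_win w' x), (area_win w' (swap x i)) by auto.
  rewrite (zsum_swap (fun z => z)) by auto using NoDup_sites. ring.
Qed.

Lemma area_ge x z : fin x -> x z <> Oconf z -> (Z.abs z <= Z.of_nat (area x))%Z.
Proof.
  intros [w H] Hz. rewrite (area_win w x H), <- (dev_term_abs x z Hz).
  apply (zsum_ge_term (sites w) (fun z => (z * dev x z)%Z)).
  - intros; apply dev_term_nonneg.
  - apply In_sites. apply NNPP; intros Hc. apply Hz, H. lia.
Qed.

(** A deviation outside the window would by itself cost at least [m]. This makes the chain killed at
    level [m] a finite one. *)
Lemma area_lt_win x m : fin x -> (area x < m)%nat -> win m x.
Proof.
  intros Hf Hm z Hz. apply NNPP; intros Hc. apply area_ge in Hc; auto. lia.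
Qed.

(** Same number of particles as [Oconf]; by [reach_neutral] and [neutral_reach] these are exactly
    the reachable configurations. The factor 1 gives the sum the form treated by [zsum_win] and
    [zsum_swap]. *)
Definition neutral (x : conf) : Prop :=
  exists w, win w x /\ zsum (sites w) (fun z => (1 * dev x z)%Z) = 0%Z.

Lemma neutral_fin x : neutral x -> fin x.
Proof. intros [w [H _]]; exists w; auto. Qed.

Lemma neutral_O : neutral Oconf.
Proof. exists 0%nat. split; [apply win_O|reflexivity]. Qed.

Lemma neutral_swap x i : neutral x -> neutral (swap x i).
Proof.
  intros [w [H Hs]]. destruct (win_swap w x i H) as (w' & Hw & H1 & H2 & H3 & H4).
  exists w'. split; auto. rewrite (zsum_swap (fun _ => 1%Z)) by auto using NoDup_sites.
  rewrite (zsum_win (fun _ => 1%Z) w) by auto. rewrite Hs. lia.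
Qed.

Lemma zsum_opp l f : zsum l (fun z => (- f z)%Z) = (- zsum l f)%Z.
Proof. induction l as [|a l IH]; simpl; [auto|rewrite IH; lia]. Qed.

(** Without a hole on the negative side all deviations are nonnegative, and since they sum to zero
    each of them vanishes. *)
Lemma neutral_hole_or_O x : neutral x ->
  (exists z, (z < 0)%Z /\ x z = false) \/ x = Oconf.
Proof.
  intros [w [H Hs]]. destruct (classic (exists z, (z < 0)%Z /\ x z = false)) as [|Hn]; auto.
  right. apply functional_extensionality; intros z. apply NNPP; intros Hc.
  assert (Hd : forall y, (0 <= 1 * dev x y)%Z).
  { intros y. unfold dev, Oconf. destruct (Z.ltb_spec y 0); destruct (x y) eqn:E; simpl; try lia.
    exfalso; apply Hn; exists y; auto. }
  assert (1 * dev x z <= 0)%Z.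
  { rewrite <- Hs. apply (zsum_ge_term (sites w) (fun z => (1 * dev x z)%Z)); auto.
    apply In_sites. apply NNPP; intros Hc'. apply Hc, H. lia. }
  specialize (Hd z). unfold dev in *. apply Hc.
  destruct (x z); destruct (Oconf z); simpl in *; auto; lia.
Qed.

Lemma neutral_particle_or_O x : neutral x ->
  (exists z, (0 <= z)%Z /\ x z = true) \/ x = Oconf.
Proof.
  intros [w [H Hs]]. destruct (classic (exists z, (0 <= z)%Z /\ x z = true)) as [|Hn]; auto.
  right. apply functional_extensionality; intros z. apply NNPP; intros Hc.
  assert (Hd : forall y, (0 <= - (1 * dev x y))%Z).
  { intros y. unfold dev, Oconf. destruct (Z.ltb_spec y 0); destruct (x y) eqn:E; simpl; try lia.
    exfalso; apply Hn; exists y; auto. }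
  assert (- (1 * dev x z) <= 0)%Z.
  { replace 0%Z with (- 0)%Z by lia. rewrite <- Hs, <- zsum_opp.
    apply (zsum_ge_term (sites w) (fun z => (- (1 * dev x z))%Z)); auto.
    apply In_sites. apply NNPP; intros Hc'. apply Hc, H. lia. }
  specialize (Hd z). unfold dev in *. apply Hc.
  destruct (x z); destruct (Oconf z); simpl in *; auto; lia.
Qed.

Lemma exists_ascent x a b : (a < b)%Z -> x a = false -> x b = true ->
  exists i, x i = false /\ x (i + 1)%Z = true.
Proof.
  intros Hab Ha Hb. replace b with (a + Z.of_nat (Z.to_nat (b - a)))%Z in Hb by lia.
  clear Hab. revert Hb. induction (Z.to_nat (b - a)) as [|n IH]; intros Hb.
  - rewrite Z.add_0_r in Hb. congruence.
  - destruct (x (a + Z.of_nat n)%Z) eqn:E; auto.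
    exists (a + Z.of_nat n)%Z. split; auto.
    replace (a + Z.of_nat n + 1)%Z with (a + Z.of_nat (S n))%Z by lia. auto.
Qed.

Lemma reach_neutral n x : reach n x -> neutral x.
Proof. induction 1; auto using neutral_O, neutral_swap. Qed.

Lemma reach_area_le n x : reach n x -> (area x <= n)%nat.
Proof.
  induction 1 as [|n x i H IH Hi]; [rewrite area_O; auto|].
  pose proof (area_swap x i (neutral_fin x (reach_neutral n x H))).
  destruct (x i), (x (i+1)%Z); simpl in *; lia.
Qed.

(** Induction on the area. Away from [Oconf] there is a hole to the left of some particle, hence an
    empty site directly followed by an occupied one; the left jump there lowers the area by one, and
    undoing it is the last jump of a path to [x]. *)
Lemma neutral_reach x : neutral x -> reach (area x) x.
Proof.
  remember (area x) as a eqn:Ea. revert x Ea.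
  induction a as [|a IH]; intros x Ea Hx; pose proof (neutral_fin x Hx) as Hf;
  (destruct (neutral_hole_or_O x Hx) as [[z [Hz1 Hz2]]|HO];
    [|subst x; rewrite area_O in Ea; try discriminate; constructor]).
  - assert (x z <> Oconf z).
    { rewrite Hz2. unfold Oconf. destruct (Z.ltb_spec z 0); [discriminate|lia]. }
    apply area_ge in H; auto. lia.
  - destruct (neutral_particle_or_O x Hx) as [[y [Hy1 Hy2]]|HO];
      [|subst x; rewrite area_O in Ea; discriminate].
    destruct (exists_ascent x z y) as [i [Hi1 Hi2]]; auto; [lia|].
    rewrite <- (swap_swap x i). constructor.
    + apply IH; [|apply neutral_swap; auto].
      pose proof (area_swap x i Hf). rewrite Hi1, Hi2 in H. simpl in H. lia.
    + rewrite swap_l, swap_r, Hi1, Hi2. discriminate.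
Qed.

(** A jump changes the area by one, so no path is shorter than the area, and [neutral_reach]
    provides a path of that length. *)
Lemma Dnum_area x : neutral x -> Dnum x = area x.
Proof.
  intros Hx. unfold Dnum.
  destruct (epsilon_spec (inhabits 0%nat)
    (fun n => reach n x /\ forall m, reach m x -> (n <= m)%nat)) as [H1 H2].
  - exists (area x). split; [apply neutral_reach; auto|]. intros m; apply reach_area_le.
  - apply Nat.le_antisymm; [apply H2, neutral_reach; auto|apply reach_area_le; auto].
Qed.

(** * The position of the rightmost particle *)

Definition is_top (x : conf) (z : Z) : Prop :=
  x z = true /\ forall w, x w = true -> (w <= z)%Z.

Lemma Mpos_top x : fin x -> is_top x (Mpos x).
Proof.
  intros [w H]. unfold Mpos. apply epsilon_spec.
  assert (Hb : forall n, (exists z, x z = true /\ (Z.of_nat w - Z.of_nat n <= z)%Z) ->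
     exists z, is_top x z).
  { induction n as [|n IH]; intros [z [Hz1 Hz2]].
    - rewrite H in Hz1 by lia. unfold Oconf in Hz1. apply Z.ltb_lt in Hz1. lia.
    - destruct (classic (exists z, x z = true /\ (Z.of_nat w - Z.of_nat n <= z)%Z)) as [|Hn]; auto.
      exists z. split; auto. intros y Hy.
      apply Z.le_ngt; intros Hc. apply Hn. exists y; split; auto. lia. }
  (* Depth [2 w + 1] below [w] reaches the site [- w - 1], the first one left of the window, which
     is occupied. *)
  apply (Hb (2 * w + 1)%nat). exists (- Z.of_nat w - 1)%Z. split; [|lia].
  rewrite H by lia. apply Z.ltb_lt. lia.
Qed.

Lemma is_top_unique x y z : is_top x y -> is_top x z -> y = z.
Proof. intros [H1 H2] [H3 H4]. apply Z.le_antisymm; auto. Qed.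

Lemma Mpos_le_area x : fin x -> (Mpos x <= Z.of_nat (area x))%Z.
Proof.
  intros Hf. destruct (Mpos_top x Hf) as [H _].
  destruct (Z.lt_ge_cases (Mpos x) 0); [lia|].
  apply (Z.le_trans _ (Z.abs (Mpos x))); [lia|]. apply area_ge; auto.
  rewrite H. unfold Oconf. destruct (Z.ltb_spec (Mpos x) 0); [lia|discriminate].
Qed.

Lemma Mpos_O : Mpos Oconf = (-1)%Z.
Proof.
  apply (is_top_unique Oconf); [apply Mpos_top; exists 0%nat; apply win_O|].
  split; [reflexivity|]. intros w Hw. apply Z.ltb_lt in Hw. lia.
Qed.

Lemma Mpos_neutral x : neutral x -> (-1 <= Mpos x)%Z.
Proof.
  intros Hx. destruct (neutral_particle_or_O x Hx) as [[z [H1 H2]]| ->].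
  - destruct (Mpos_top x (neutral_fin x Hx)) as [_ H]. specialize (H z H2). lia.
  - rewrite Mpos_O; lia.
Qed.

Lemma Mpos_swap_top x : fin x -> Mpos (swap x (Mpos x)) = (Mpos x + 1)%Z.
Proof.
  intros Hf. destruct (Mpos_top x Hf) as [H1 H2].
  apply (is_top_unique (swap x (Mpos x))); [apply Mpos_top, fin_swap; auto|].
  split; [rewrite swap_r; auto|]. intros w Hw.
  destruct (Z.eq_dec w (Mpos x)); [lia|]. destruct (Z.eq_dec w (Mpos x + 1)); [lia|].
  rewrite swap_other in Hw by auto. apply H2 in Hw. lia.
Qed.

Lemma Mpos_swap_below_top x : fin x -> x (Mpos x - 1)%Z = false ->
  Mpos (swap x (Mpos x - 1)) = (Mpos x - 1)%Z.
Proof.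
  intros Hf Hx. destruct (Mpos_top x Hf) as [H1 H2].
  apply (is_top_unique (swap x (Mpos x - 1))); [apply Mpos_top, fin_swap; auto|].
  split; [rewrite swap_l, Z.sub_add; auto|]. intros w Hw.
  destruct (Z.eq_dec w (Mpos x - 1)); [lia|].
  destruct (Z.eq_dec w (Mpos x)) as [->|].
  - replace (Mpos x) with (Mpos x - 1 + 1)%Z in Hw at 2 by lia. rewrite swap_r in Hw. congruence.
  - rewrite swap_other in Hw by lia. apply H2 in Hw. lia.
Qed.

Lemma Mpos_swap_other x i : fin x -> x i <> x (i + 1)%Z -> i <> Mpos x -> i <> (Mpos x - 1)%Z ->
  Mpos (swap x i) = Mpos x.
Proof.
  intros Hf Hx Hi1 Hi2. destruct (Mpos_top x Hf) as [H1 H2].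
  (* All sites beyond the top particle are empty, so a possible jump not involving that particle
     takes place strictly to its left. *)
  assert (Hlt : (i + 1 < Mpos x)%Z).
  { destruct (Z.lt_ge_cases (i + 1) (Mpos x)); auto.
    assert (Hfalse : forall z, (Mpos x < z)%Z -> x z = false).
    { intros z Hz. destruct (x z) eqn:E; auto. apply H2 in E. lia. }
    exfalso. apply Hx. rewrite !Hfalse by lia. auto. }
  apply (is_top_unique (swap x i)); [apply Mpos_top, fin_swap; auto|].
  split; [rewrite swap_other by lia; auto|]. intros w Hw.
  destruct (Z.eq_dec w i); [lia|]. destruct (Z.eq_dec w (i+1)); [lia|].
  rewrite swap_other in Hw by lia. apply H2 in Hw. lia.
Qed.

(** * Jump rates *)

Lemma rate_zero p x i : x i = x (i + 1)%Z -> rate p x i = 0.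
Proof. intros H. unfold rate. rewrite H. destruct (x (i + 1)%Z); auto. Qed.

Lemma rate_bounds p x i : 0 < p < 1 -> 0 <= rate p x i <= 1.
Proof. intros Hp. unfold rate. destruct (x i), (x (i + 1)%Z); simpl; lra. Qed.

(** The left end is widened by one because the edge [- w - 1] touches the window. This also keeps
    the edge -1, where [Oconf] itself has its step, inside even when [w = 0]. *)
Lemma rate_outside p w x z : win w x ->
  (z < - Z.of_nat (S w) \/ Z.of_nat w <= z)%Z -> rate p x z = 0.
Proof.
  intros H Hz. apply rate_zero. rewrite !H by lia.
  unfold Oconf. destruct (Z.ltb_spec z 0), (Z.ltb_spec (z + 1) 0); auto; lia.
Qed.

Lemma qout_sites p w x : win w x -> qout p x = lsum (sites (S w)) (rate p x).
Proof.
  intros H. apply Series_sites. intros z Hz. apply (rate_outside p w); auto. lia.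
Qed.

Lemma qout_nonneg p x : 0 < p < 1 -> fin x -> 0 <= qout p x.
Proof.
  intros Hp [w H]. rewrite (qout_sites p w) by auto.
  apply lsum_nonneg. intros; apply rate_bounds; auto.
Qed.

Lemma ind_bounds P : 0 <= ind P <= 1.
Proof. unfold ind. destruct excluded_middle_informative; lra. Qed.

Lemma ind_true (P : Prop) : P -> ind P = 1.
Proof. intros H. unfold ind. destruct excluded_middle_informative; tauto. Qed.

Lemma ind_false (P : Prop) : ~ P -> ind P = 0.
Proof. intros H. unfold ind. destruct excluded_middle_informative; tauto. Qed.

Lemma ind_ext (P Q : Prop) : (P <-> Q) -> ind P = ind Q.
Proof. intros H. unfold ind. do 2 destruct excluded_middle_informative; tauto. Qed.

(** * Differential equations *)

Lemma is_derive_lsum {A} (l : list A) (f : A -> R -> R) (df : A -> R) t :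
  (forall a, In a l -> is_derive (f a) t (df a)) ->
  is_derive (fun s => lsum l (fun a => f a s)) t (lsum l df).
Proof.
  induction l as [|a l IH]; intros H; simpl.
  - apply (is_derive_const (K := R_AbsRing) (V := R_NormedModule) 0).
  - apply (is_derive_plus (K := R_AbsRing) (V := R_NormedModule) (f a));
    [apply H; left; auto|apply IH; intros; apply H; right; auto].
Qed.

Lemma derive_lower_bound (f df : R -> R) (b t : R) :
  (forall s, is_derive f s (df s)) -> 0 <= t ->
  (forall s, 0 <= s <= t -> b <= df s) -> f 0 + b * t <= f t.
Proof.
  intros Hd Ht Hb. destruct (Req_dec t 0) as [->|Hn]; [lra|].
  destruct (MVT_gen f 0 t df) as [c [Hc He]].
  - intros x _; apply Hd.
  - intros x _. apply continuity_pt_filterlim.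
    apply (ex_derive_continuous f). exists (df x). apply Hd.
  - rewrite Rmin_left, Rmax_right in Hc by lra. specialize (Hb c Hc). nra.
Qed.

(** With the integrating factor [exp (q s)] the derivative of [exp (q s) * f s] is
    [exp (q s) * g s]. This is the comparison principle behind all estimates on [G]. *)
Lemma ode_nonneg (q : R) (f g : R -> R) (t : R) :
  (forall s, is_derive f s (- q * f s + g s)) -> 0 <= t ->
  (forall s, 0 <= s <= t -> 0 <= g s) -> 0 <= f 0 -> 0 <= f t.
Proof.
  intros Hd Ht Hg H0.
  assert (H : exp (q * 0) * f 0 + 0 * t <= exp (q * t) * f t).
  { apply (derive_lower_bound (fun s => exp (q * s) * f s) (fun s => exp (q * s) * g s)); auto.
    - intros s. specialize (Hd s).
      evar_last. apply (is_derive_mult (fun s => exp (q * s)) f s (q * exp (q * s)) (- q * f s + g s)).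
      + auto_derive; auto. ring.
      + apply Hd.
      + intros; apply Rmult_comm.
      + unfold plus, mult; simpl. ring.
    - intros s Hs. apply Rmult_le_pos; [left; apply exp_pos|auto]. }
  rewrite Rmult_0_r, exp_0 in H. pose proof (exp_pos (q * t)). nra.
Qed.

Definition conv (q : R) (g : R -> R) (t : R) : R :=
  RInt (fun s => exp (- q * s) * g (t - s)) 0 t.

(** The substitution [u = t - s] removes [t] from the integrand, so that the derivative in [t]
    follows from the fundamental theorem of calculus. *)
Lemma conv_reflect (q : R) (g : R -> R) (t : R) : (forall s, continuous g s) ->
  conv q g t = exp (- q * t) * RInt (fun u => exp (q * u) * g u) 0 t.
Proof.
  intros Hg. unfold conv. set (f := fun u => exp (q * u) * g u).
  assert (Hf : forall s, continuous f s).
  { intros s. apply (continuous_mult (K := R_AbsRing)); auto.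
    apply (ex_derive_continuous (fun u => exp (q * u))). auto_derive; auto. }
  assert (He : forall a b, ex_RInt f a b)
    by (intros; apply (ex_RInt_continuous (V := R_CompleteNormedModule)); auto).
  assert (H : RInt (fun y => -1 * f (-1 * y + t)) 0 t = - RInt f 0 t).
  { etransitivity; [apply (RInt_comp_lin f (-1) t 0 t); auto|].
    replace (-1 * 0 + t) with t by ring. replace (-1 * t + t) with 0 by ring.
    symmetry. apply (opp_RInt_swap f). auto. }
  assert (Hc : ex_RInt (fun y => -1 * f (-1 * y + t)) 0 t)
    by (apply (ex_RInt_comp_lin f); auto).
  transitivity (- exp (- q * t) * RInt (fun y => -1 * f (-1 * y + t)) 0 t).
  - etransitivity; [|apply (RInt_scal (V := R_CompleteNormedModule) _ 0 t (- exp (- q * t)) Hc)].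
    apply RInt_ext. intros s _. unfold f, scal; simpl. unfold mult; simpl.
    replace (-1 * s + t) with (t - s) by ring.
    replace (- q * s) with (- q * t + q * (t - s)) by ring. rewrite exp_plus. ring.
  - rewrite H. ring.
Qed.

Lemma is_derive_conv (q : R) (g : R -> R) (t : R) : (forall s, continuous g s) ->
  is_derive (conv q g) t (- q * conv q g t + g t).
Proof.
  intros Hg. apply (is_derive_ext (fun t => exp (- q * t) * RInt (fun u => exp (q * u) * g u) 0 t)).
  { intros s. rewrite conv_reflect; auto. }
  assert (Hf : forall s, continuous (fun u => exp (q * u) * g u) s).
  { intros s. apply (continuous_mult (K := R_AbsRing)); auto.
    apply (ex_derive_continuous (fun u => exp (q * u))). auto_derive; auto. }
  evar_last.
  - apply (is_derive_mult (fun s => exp (- q * s))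
      (fun t => RInt (fun u => exp (q * u) * g u) 0 t) t
      (- q * exp (- q * t)) (exp (q * t) * g t)).
    + auto_derive; auto. ring.
    + apply (is_derive_RInt (V := R_NormedModule) (fun u => exp (q * u) * g u) _ 0).
      * apply filter_forall. intros b. apply (RInt_correct (V := R_CompleteNormedModule)).
        apply (ex_RInt_continuous (V := R_CompleteNormedModule)); auto.
      * apply Hf.
    + intros; apply Rmult_comm.
  - rewrite conv_reflect by auto. unfold plus, mult; simpl.
    assert (exp (- q * t) * exp (q * t) = 1).
    { rewrite <- exp_plus. replace (- q * t + q * t) with 0 by ring. apply exp_0. }
    replace (exp (- q * t) * (exp (q * t) * g t)) with (exp (- q * t) * exp (q * t) * g t) by ring.
    rewrite H. ring.
Qed.

Lemma RInt_eq (f g : R -> R) a b : (forall s, f s = g s) -> RInt f a b = RInt g a b.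
Proof. intros H. apply RInt_ext. intros; apply H. Qed.

Lemma RInt_zero (f : R -> R) a b : (forall s, f s = 0) -> RInt f a b = 0.
Proof.
  intros H. rewrite (RInt_ext f (fun _ => 0)) by (intros; apply H).
  rewrite RInt_const. unfold scal; simpl. unfold mult; simpl. ring.
Qed.

(** * Backward equations for [G] *)

Lemma G_S_conv p Ev n hist x t w : win w x ->
  G p Ev (S n) hist x t =
  lsum (sites (S w)) (fun i =>
    conv (qout p x) (fun s => rate p x i * G p Ev n (x :: hist) (swap x i) s) t).
Proof.
  intros H. cbn [G].
  set (f := fun i => conv (qout p x) (fun s => rate p x i * G p Ev n (x :: hist) (swap x i) s) t).
  rewrite <- (Series_sites f).
  - apply Series_ext. intros k. unfold f, conv. apply RInt_eq. intros s. ring.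
  - intros z Hz. unfold f, conv. rewrite (rate_outside p w) by (auto; lia).
    apply RInt_zero. intros; ring.
Qed.

Lemma is_derive_G_0 p Ev hist x t :
  is_derive (G p Ev 0 hist x) t (- qout p x * G p Ev 0 hist x t).
Proof.
  change (G p Ev 0 hist x) with (fun s => ind (Ev (rev (x :: hist))) * exp (- qout p x * s)).
  generalize (ind (Ev (rev (x :: hist)))) (qout p x); intros a q.
  auto_derive; auto. ring.
Qed.

Lemma continuous_G p Ev n hist x t : fin x -> continuous (G p Ev n hist x) t.
Proof.
  revert hist x t. induction n as [|n IH]; intros hist x t Hf.
  - apply (ex_derive_continuous (G p Ev 0 hist x)). eexists. apply is_derive_G_0.
  - destruct Hf as [w H]. apply (ex_derive_continuous (G p Ev (S n) hist x)). eexists.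
    apply (is_derive_ext (fun t => lsum (sites (S w)) (fun i =>
    conv (qout p x) (fun s => rate p x i * G p Ev n (x :: hist) (swap x i) s) t))).
    { intros s. symmetry. apply G_S_conv; auto. }
    apply is_derive_lsum. intros i _. apply is_derive_conv. intros s.
    apply (continuous_mult (K := R_AbsRing)); [apply continuous_const|].
    apply IH, fin_swap. exists w; auto.
Qed.

Lemma is_derive_G_S p Ev n hist x t w : win w x ->
  is_derive (G p Ev (S n) hist x) t
    (- qout p x * G p Ev (S n) hist x t
     + lsum (sites (S w)) (fun i => rate p x i * G p Ev n (x :: hist) (swap x i) t)).
Proof.
  intros H. apply (is_derive_ext (fun t => lsum (sites (S w)) (fun i =>
    conv (qout p x) (fun s => rate p x i * G p Ev n (x :: hist) (swap x i) s) t))).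
  { intros s. symmetry. apply G_S_conv; auto. }
  evar_last.
  - apply is_derive_lsum. intros i _. apply is_derive_conv. intros s.
    apply (continuous_mult (K := R_AbsRing)); [apply continuous_const|].
    apply continuous_G, fin_swap. exists w; auto.
  - rewrite lsum_plus, lsum_scal. rewrite <- G_S_conv by auto. reflexivity.
Qed.

Lemma G_0_at_0 p Ev hist x : G p Ev 0 hist x 0 = ind (Ev (rev (x :: hist))).
Proof. cbn [G]. rewrite Rmult_0_r, exp_0. ring. Qed.

Lemma G_S_at_0 p Ev n hist x : fin x -> G p Ev (S n) hist x 0 = 0.
Proof.
  intros [w H]. rewrite (G_S_conv _ _ _ _ _ _ w) by auto. apply lsum_zero.
  intros i _. unfold conv. apply (RInt_point (V := R_CompleteNormedModule)).
Qed.

(** The event is only ever tested on full paths that extend the current history, so history and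
    event may be changed together. *)
Lemma G_ext p Ev Ev' n hist hist' x t :
  (forall l, Ev (rev hist ++ x :: l) <-> Ev' (rev hist' ++ x :: l)) ->
  G p Ev n hist x t = G p Ev' n hist' x t.
Proof.
  revert hist hist' x t. induction n as [|n IH]; intros hist hist' x t H; cbn [G].
  - f_equal. apply ind_ext. cbn [rev]. apply H.
  - apply Series_ext. intros k. apply RInt_ext. intros s _. f_equal. apply IH.
    intros l. cbn [rev]. rewrite <- !app_assoc. apply H.
Qed.

Lemma G_false p n hist x t : G p (fun _ => False) n hist x t = 0.
Proof.
  revert hist x t. induction n as [|n IH]; intros hist x t; cbn [G].
  - rewrite ind_false by tauto. ring.
  - rewrite (Series_ext _ (fun _ => 0)).
    + apply is_series_unique. exact (is_series_finite_support (fun _ => 0) 0 (fun _ _ => eq_refl)).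
    + intros k. apply RInt_zero. intros s; rewrite IH; ring.
Qed.

Lemma G_zero p Ev n hist x t :
  (forall l, ~ Ev (rev hist ++ x :: l)) -> G p Ev n hist x t = 0.
Proof.
  intros H. rewrite (G_ext p Ev (fun _ => False) n hist hist) by (intros; split; [apply H|tauto]).
  apply G_false.
Qed.

(** An invariant of the jumps that have positive rate, strong enough to supply the finite window
    needed in the differential equations. *)
Definition stable (P : conf -> Prop) : Prop :=
  (forall x, P x -> fin x) /\ (forall x i, P x -> x i <> x (i + 1)%Z -> P (swap x i)).

Lemma stable_fin : stable fin.
Proof. split; auto using fin_swap. Qed.

Lemma stable_neutral : stable neutral.
Proof. split; auto using neutral_fin, neutral_swap. Qed.

Lemma rate_term_le p x i a b :
  0 < p < 1 -> (x i <> x (i + 1)%Z -> a <= b) -> rate p x i * a <= rate p x i * b.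
Proof.
  intros Hp H. destruct (Bool.bool_dec (x i) (x (i + 1)%Z)) as [E|E].
  - rewrite rate_zero by auto. lra.
  - apply Rmult_le_compat_l; auto. apply rate_bounds; auto.
Qed.

(** A linear inequality between indicators that holds on every path in [P] passes to the
    probabilities. This takes the place of monotonicity and additivity of a measure on paths. By
    induction on the number of jumps, the combination solves an equation with nonnegative source and
    nonnegative initial value. *)
Lemma G_linear p (P : conf -> Prop) (cs : list (R * (list conf -> Prop))) n hist x t :
  0 < p < 1 -> stable P ->
  (forall l, Forall P l -> 0 <= lsum cs (fun c => fst c * ind (snd c l))) ->
  Forall P hist -> P x -> 0 <= t ->
  0 <= lsum cs (fun c => fst c * G p (snd c) n hist x t).
Proof.
  intros Hp [Hfin Hst] Hcs. revert hist x t.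
  induction n as [|n IH]; intros hist x t Hh Hx Ht.
  - apply (ode_nonneg (qout p x)
      (fun t => lsum cs (fun c => fst c * G p (snd c) 0 hist x t)) (fun _ => 0)); auto.
    + intros s. evar_last.
      * apply is_derive_lsum. intros c _. apply is_derive_scal. apply is_derive_G_0.
      * rewrite Rplus_0_r, <- lsum_scal. apply lsum_ext. intros; simpl. ring.
    + intros; lra.
    + rewrite (lsum_ext _ _ (fun c => fst c * ind (snd c (rev (x :: hist)))))
        by (intros; rewrite G_0_at_0; auto).
      apply Hcs. apply Forall_rev. constructor; auto.
  - destruct (Hfin x Hx) as [w Hw].
    apply (ode_nonneg (qout p x)
      (fun t => lsum cs (fun c => fst c * G p (snd c) (S n) hist x t))
      (fun t => lsum (sites (S w)) (fun i => rate p x i *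
          lsum cs (fun c => fst c * G p (snd c) n (x :: hist) (swap x i) t)))); auto.
    + intros s. evar_last.
      * apply is_derive_lsum. intros c _. apply is_derive_scal. apply is_derive_G_S; eauto.
      * rewrite (lsum_ext (sites (S w)) _ (fun i => lsum cs (fun c =>
           fst c * (rate p x i * G p (snd c) n (x :: hist) (swap x i) s)))).
        2:{ intros. rewrite <- lsum_scal. apply lsum_ext. intros; ring. }
        rewrite (lsum_exchange (sites (S w))), <- lsum_scal, <- lsum_plus.
        apply lsum_ext. intros c _. rewrite lsum_scal. unfold scal; simpl. unfold mult; simpl. ring.
    + intros s Hs. apply lsum_nonneg. intros i _.
      replace 0 with (rate p x i * 0) at 1 by ring.
      apply rate_term_le; auto. intros Hi. apply IH; auto. lra.
    + rewrite lsum_zero; [lra|]. intros. rewrite G_S_at_0; [ring|auto].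
Qed.

Lemma G_nonneg p Ev n hist x t : 0 < p < 1 -> fin x -> Forall fin hist -> 0 <= t ->
  0 <= G p Ev n hist x t.
Proof.
  intros Hp Hx Hh Ht.
  pose proof (G_linear p fin [(1, Ev)] n hist x t Hp stable_fin) as H. simpl in H.
  rewrite Rplus_0_r, Rmult_1_l in H. apply H; auto.
  intros l _. pose proof (ind_bounds (Ev l)). lra.
Qed.

(** * Probabilities restricted to at most [N] jumps *)

Definition GS p Ev N hist x t : R := sum_n (fun n => G p Ev n hist x t) N.

Lemma GS_0 p Ev hist x t : GS p Ev 0 hist x t = G p Ev 0 hist x t.
Proof. unfold GS. rewrite sum_O. reflexivity. Qed.

Lemma GS_S p Ev N hist x t :
  GS p Ev (S N) hist x t = GS p Ev N hist x t + G p Ev (S N) hist x t.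
Proof. unfold GS. rewrite sum_Sn. reflexivity. Qed.

Lemma is_derive_GS_S p Ev N hist x t w : win w x ->
  is_derive (GS p Ev (S N) hist x) t
    (- qout p x * GS p Ev (S N) hist x t
     + lsum (sites (S w)) (fun i => rate p x i * GS p Ev N (x :: hist) (swap x i) t)).
Proof.
  intros H. induction N as [|N IH].
  - apply (is_derive_ext (fun t => G p Ev 0 hist x t + G p Ev 1 hist x t)).
    { intros; rewrite GS_S, GS_0; auto. }
    evar_last.
    + apply (is_derive_plus (K := R_AbsRing) (V := R_NormedModule));
        [apply is_derive_G_0|apply is_derive_G_S; eauto].
    + unfold plus; simpl. rewrite GS_S, GS_0.
      rewrite Rmult_plus_distr_l, Rplus_assoc. f_equal. f_equal.
      apply (lsum_ext (sites (S w))). intros; rewrite GS_0; auto.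
  - apply (is_derive_ext (fun t => GS p Ev (S N) hist x t + G p Ev (S (S N)) hist x t)).
    { intros; rewrite (GS_S p Ev (S N)); auto. }
    evar_last.
    + apply (is_derive_plus (K := R_AbsRing) (V := R_NormedModule));
        [apply IH|apply is_derive_G_S; eauto].
    + rewrite (lsum_ext (sites (S w)) (fun i => rate p x i * GS p Ev (S N) (x :: hist) (swap x i) t)
         (fun i => rate p x i * GS p Ev N (x :: hist) (swap x i) t +
                   rate p x i * G p Ev (S N) (x :: hist) (swap x i) t)).
      2:{ intros; rewrite GS_S; ring. }
      rewrite lsum_plus. rewrite (GS_S p Ev (S N)). unfold plus; simpl. ring.
Qed.

Lemma GS_S_at_0 p Ev N hist x : fin x -> GS p Ev N hist x 0 = ind (Ev (rev (x :: hist))).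
Proof.
  intros Hf. induction N as [|N IH]; [rewrite GS_0; apply G_0_at_0|].
  rewrite GS_S, IH, G_S_at_0 by auto. ring.
Qed.

(** [exp (- lam t) h] is a supersolution of the backward equation; [h] need only be controlled
    while the event is still possible. *)
Lemma GS_le_super p (P : conf -> Prop) Ev (h : conf -> R) (lam : R) N hist x t :
  0 < p < 1 -> stable P -> (forall y, P y -> 0 <= h y) ->
  (forall hist y w, P y -> win w y ->
     (forall l, ~ Ev (rev hist ++ y :: l)) \/
     (ind (Ev (rev (y :: hist))) <= h y /\
      lsum (sites (S w)) (fun i => rate p y i * h (swap y i)) <= (qout p y - lam) * h y)) ->
  P x -> 0 <= t -> GS p Ev N hist x t <= exp (- lam * t) * h x.
Proof.
  intros Hp [Hfin Hst] Hh Hs. revert hist x t.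
  induction N as [|N IH]; intros hist x t Hx Ht; destruct (Hfin x Hx) as [w Hw];
  (destruct (Hs hist x w Hx Hw) as [Hz|[H1 H2]];
   [ replace (GS _ _ _ _ _ _) with 0;
     [ apply Rmult_le_pos; [left; apply exp_pos|auto]
     | symmetry; unfold GS; rewrite sum_n_lsum; apply lsum_zero; intros; apply G_zero; auto ]
   | apply Rminus_le_0 ]).
  - apply (ode_nonneg (qout p x) (fun t => exp (- lam * t) * h x - GS p Ev 0 hist x t)
      (fun t => exp (- lam * t) * ((qout p x - lam) * h x))); auto.
    + intros s. evar_last.
      * apply (is_derive_minus (K := R_AbsRing) (V := R_NormedModule)).
        -- instantiate (1 := - lam * exp (- lam * s) * h x). auto_derive; auto. ring.
        -- apply (is_derive_ext (G p Ev 0 hist x)); [intros; rewrite GS_0; auto|].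
           apply is_derive_G_0.
      * rewrite GS_0. unfold minus, plus, opp; simpl. ring.
    + intros s Hs'. apply Rmult_le_pos; [left; apply exp_pos|].
      eapply Rle_trans; [|apply H2]. apply lsum_nonneg. intros i _.
      replace 0 with (rate p x i * 0) by ring. apply rate_term_le; auto.
    + rewrite GS_S_at_0 by auto. rewrite Rmult_0_r, exp_0. lra.
  - apply (ode_nonneg (qout p x) (fun t => exp (- lam * t) * h x - GS p Ev (S N) hist x t)
      (fun t => exp (- lam * t) * ((qout p x - lam) * h x) -
         lsum (sites (S w)) (fun i => rate p x i * GS p Ev N (x :: hist) (swap x i) t))); auto.
    + intros s. evar_last.
      * apply (is_derive_minus (K := R_AbsRing) (V := R_NormedModule)).
        -- instantiate (1 := - lam * exp (- lam * s) * h x). auto_derive; auto. ring.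
        -- apply is_derive_GS_S; eauto.
      * unfold minus, plus, opp; simpl. ring.
    + intros s Hs'. apply Rle_minus_r. rewrite Rplus_0_l.
      apply Rle_trans with (exp (- lam * s) * lsum (sites (S w)) (fun i => rate p x i * h (swap x i))).
      * rewrite <- lsum_scal. apply lsum_le. intros i _.
        replace (exp (- lam * s) * (rate p x i * h (swap x i))) with
          (rate p x i * (exp (- lam * s) * h (swap x i))) by ring.
        apply rate_term_le; auto. intros Hi. apply IH; auto. lra.
      * apply Rmult_le_compat_l; auto. left; apply exp_pos.
    + rewrite GS_S_at_0 by auto. rewrite Rmult_0_r, exp_0. lra.
Qed.

(** The constant 1 is harmonic, hence a supersolution with [lam = 0]. *)
Lemma GS_le_1 p Ev N hist x t : 0 < p < 1 -> fin x -> 0 <= t -> GS p Ev N hist x t <= 1.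
Proof.
  intros Hp Hx Ht. replace 1 with (exp (- 0 * t) * (fun _ : conf => 1) x).
  2:{ rewrite Ropp_0, Rmult_0_l, exp_0; ring. }
  apply (GS_le_super p fin Ev (fun _ => 1) 0); auto using stable_fin; [intros; lra|].
  intros hist' y w _ Hw. right. split; [apply ind_bounds|].
  rewrite (qout_sites p w) by auto. rewrite (lsum_ext _ _ (rate p y)) by (intros; ring). lra.
Qed.

Lemma GS_mono p Ev N hist x t : 0 < p < 1 -> fin x -> Forall fin hist -> 0 <= t ->
  GS p Ev N hist x t <= GS p Ev (S N) hist x t.
Proof.
  intros. rewrite GS_S. assert (0 <= G p Ev (S N) hist x t) by (apply G_nonneg; auto). lra.
Qed.

Lemma GS_nonneg p Ev N hist x t : 0 < p < 1 -> fin x -> Forall fin hist -> 0 <= t ->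
  0 <= GS p Ev N hist x t.
Proof.
  intros. unfold GS. rewrite sum_n_lsum. apply lsum_nonneg. intros; apply G_nonneg; auto.
Qed.

(** The partial sums increase and are at most 1, so [Prob] is a genuine limit and not a default
    value of [Series]. *)
Lemma Prob_lim p Ev t : 0 < p < 1 -> 0 <= t ->
  is_lim_seq (fun N => GS p Ev N [] Oconf t) (Prob p Ev t).
Proof.
  intros Hp Ht. assert (HO : fin Oconf) by (exists 0%nat; apply win_O).
  destruct (ex_finite_lim_seq_incr (fun N => GS p Ev N [] Oconf t) 1) as [l Hl].
  - intros; apply GS_mono; auto.
  - intros; apply GS_le_1; auto.
  - replace (Prob p Ev t) with l; [exact Hl|]. symmetry. apply is_series_unique. exact Hl.
Qed.

(** * Reflection [p -> 1 - p] *)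

(** The sum telescopes. On a window containing all deviations it equals 1: possible right jumps
    outnumber possible left jumps by exactly one. *)
Lemma lsum_gradient (x : conf) w :
  lsum (sites w) (fun i => IZR (Z.b2z (x i) - Z.b2z (x (i + 1)%Z))) =
  IZR (Z.b2z (x (- Z.of_nat w)%Z) - Z.b2z (x (Z.of_nat w))).
Proof.
  induction w as [|w IH]; [simpl; rewrite Z.sub_diag; auto|]. cbn [sites].
  rewrite lsum_app, IH. cbn [lsum fold_right].
  replace (- Z.of_nat w - 1 + 1)%Z with (- Z.of_nat w)%Z by lia.
  replace (- Z.of_nat w - 1)%Z with (- Z.of_nat (S w))%Z by lia.
  replace (Z.of_nat w + 1)%Z with (Z.of_nat (S w)) by lia.
  rewrite !minus_IZR. ring.
Qed.

Lemma qout_reflect p x : fin x -> qout p x = qout (1 - p) x + (2 * p - 1).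
Proof.
  intros [w H]. rewrite !(qout_sites _ w) by auto.
  pose proof (lsum_gradient x (S w)) as Hg. rewrite !H in Hg by lia.
  unfold Oconf in Hg.
  destruct (Z.ltb_spec (- Z.of_nat (S w)) 0), (Z.ltb_spec (Z.of_nat (S w)) 0); try lia.
  change (IZR (Z.b2z true - Z.b2z false)) with 1 in Hg.
  rewrite <- (Rmult_1_r (2 * p - 1)), <- Hg, <- lsum_scal, <- lsum_plus.
  apply lsum_ext. intros i _. unfold rate. destruct (x i), (x (i + 1)%Z); simpl; ring.
Qed.

Lemma area_swap_right x i : fin x -> x i = true -> x (i + 1)%Z = false ->
  area (swap x i) = S (area x).
Proof. intros Hf H1 H2. pose proof (area_swap x i Hf). rewrite H1, H2 in H. simpl in H. lia. Qed.

Lemma area_swap_left x i : fin x -> x i = false -> x (i + 1)%Z = true ->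
  area x = S (area (swap x i)).
Proof. intros Hf H1 H2. pose proof (area_swap x i Hf). rewrite H1, H2 in H. simpl in H. lia. Qed.

(** A jump changes the area by one, and the resulting factor [(1 - p) / p] or its inverse exchanges
    the two rates: an h-transform. *)
Lemma rate_reflect p x i : 0 < p < 1 -> fin x ->
  rate p x i * ((1 - p) / p) ^ area (swap x i) = ((1 - p) / p) ^ area x * rate (1 - p) x i.
Proof.
  intros Hp Hf. destruct (x i) eqn:E1, (x (i + 1)%Z) eqn:E2;
    try (rewrite !rate_zero by congruence; ring).
  - rewrite area_swap_right by auto. unfold rate. rewrite E1, E2. simpl. field. lra.
  - rewrite (area_swap_left x i) by auto. unfold rate. rewrite E1, E2. simpl. field. lra.
Qed.

Lemma ode_zero (q : R) (f g : R -> R) (t : R) :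
  (forall s, is_derive f s (- q * f s + g s)) -> 0 <= t ->
  (forall s, 0 <= s <= t -> g s = 0) -> f 0 = 0 -> f t = 0.
Proof.
  intros Hd Ht Hg H0. apply Rle_antisym.
  - apply Ropp_le_cancel. rewrite Ropp_0.
    apply (ode_nonneg q (fun s => - f s) (fun s => - g s)); auto; try lra.
    + intros s. evar_last; [apply (is_derive_opp f s), Hd|]. unfold opp; simpl; ring.
    + intros s Hs. rewrite Hg; auto; lra.
  - apply (ode_nonneg q f g); auto; try lra. intros s Hs. rewrite Hg; auto; lra.
Qed.

Lemma exp_monotone a b : a <= b -> exp a <= exp b.
Proof. intros [H| ->]; [left; apply exp_increasing; auto|right; auto]. Qed.

Lemma is_derive_exp_mult (a : R) (f : R -> R) (df s : R) : is_derive f s df ->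
  is_derive (fun s => exp (a * s) * f s) s (exp (a * s) * (a * f s + df)).
Proof.
  intros H. evar_last.
  - apply (is_derive_mult (fun s => exp (a * s)) f s (a * exp (a * s)) df); auto.
    + auto_derive; auto. ring.
    + intros; apply Rmult_comm.
  - unfold plus, mult; simpl. ring.
Qed.

(** A path from [x] back to [Oconf] has [area x] more left jumps than right jumps, and
    its total exit rate differs from the reflected one by the constant [2 * p - 1]. *)
Lemma G_reflect p Ev n hist x t : 0 < p < 1 -> (forall l, Ev l -> EvO l) -> fin x -> 0 <= t ->
  G p Ev n hist x t =
  ((1 - p) / p) ^ area x * (exp (- (2 * p - 1) * t) * G (1 - p) Ev n hist x t).
Proof.
  intros Hp HO. revert hist x t. set (c := (1 - p) / p).
  induction n as [|n IH]; intros hist x t Hf Ht; apply Rminus_diag_uniq.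
  - apply (ode_zero (qout p x) (fun t => G p Ev 0 hist x t -
      c ^ area x * (exp (- (2 * p - 1) * t) * G (1 - p) Ev 0 hist x t)) (fun _ => 0)); auto.
    + intros s. evar_last.
      * apply (is_derive_minus (K := R_AbsRing) (V := R_NormedModule));
          [apply is_derive_G_0|apply is_derive_scal, is_derive_exp_mult, is_derive_G_0].
      * rewrite (qout_reflect p x) by auto.
        unfold minus, plus, opp, scal; simpl. unfold mult; simpl. ring.
    + rewrite !G_0_at_0, Rmult_0_r, exp_0.
      destruct (classic (Ev (rev (x :: hist)))) as [H|H].
      (* The event can hold only at [Oconf], whose area is 0, so the two initial values agree. *)
      * assert (x = Oconf) as ->.
        { specialize (HO _ H). unfold EvO in HO. cbn [rev] in HO. rewrite last_last in HO. auto. }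
        rewrite area_O. simpl. ring.
      * rewrite ind_false by auto. ring.
  - pose proof Hf as [w Hw].
    apply (ode_zero (qout p x) (fun t => G p Ev (S n) hist x t -
       c ^ area x * (exp (- (2 * p - 1) * t) * G (1 - p) Ev (S n) hist x t))
     (fun t => lsum (sites (S w)) (fun i => rate p x i * G p Ev n (x :: hist) (swap x i) t)
       - c ^ area x * (exp (- (2 * p - 1) * t) *
         lsum (sites (S w)) (fun i => rate (1 - p) x i * G (1 - p) Ev n (x :: hist) (swap x i) t))));
      auto.
    + intros s. evar_last.
      * apply (is_derive_minus (K := R_AbsRing) (V := R_NormedModule));
        [apply is_derive_G_S; eauto|apply is_derive_scal, is_derive_exp_mult, is_derive_G_S; eauto].
      * rewrite (qout_reflect p x) by auto.
        unfold minus, plus, opp, scal; simpl. unfold mult; simpl. ring.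
    + intros s Hs. rewrite <- !lsum_scal, <- lsum_minus. apply lsum_zero.
      intros i _. rewrite IH by (try lra; apply fin_swap; auto).
      rewrite <- Rmult_assoc. unfold c. rewrite rate_reflect by auto. ring.
    + rewrite !G_S_at_0 by auto. ring.
Qed.

Lemma fin_O : fin Oconf.
Proof. exists 0%nat; apply win_O. Qed.

Lemma Prob_reflect p Ev t : 0 < p < 1 -> (forall l, Ev l -> EvO l) -> 0 <= t ->
  Prob p Ev t = exp (- (2 * p - 1) * t) * Prob (1 - p) Ev t.
Proof.
  intros Hp HO Ht. unfold Prob. rewrite <- Series_scal_l. apply Series_ext. intros n.
  rewrite (G_reflect p) by auto using fin_O. rewrite area_O. simpl. ring.
Qed.

Lemma cp_reflect p : 0 < p < 1 -> cp p = cp (1 - p).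
Proof.
  intros Hp. unfold cp. f_equal.
  replace ((1 - (1 - p)) / (1 - p)) with (/ ((1 - p) / p)) by (field; lra).
  rewrite ln_Rinv, Rabs_Ropp; auto. apply Rdiv_lt_0_compat; lra.
Qed.

(** * The rightmost particle *)

Lemma lsum_delta (l : list Z) i c : NoDup l -> In i l ->
  lsum l (fun z => if Z.eqb z i then c else 0) = c.
Proof.
  induction 1 as [|a l Ha Hl IH]; intros Hi; [destruct Hi|]. simpl.
  destruct Hi as [->|Hi].
  - rewrite Z.eqb_refl, lsum_zero; [ring|].
    intros b Hb. destruct (Z.eqb_spec b i); subst; tauto.
  - rewrite IH by auto. destruct (Z.eqb_spec a i); subst; [tauto|ring].
Qed.

(** Because of [EvO], the supersolution of [rightmost_low_bound] has to dominate 1 only at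
    [Oconf]. *)
Definition low_event (y : R) (l : list conf) : Prop :=
  EvO l /\ forall x, In x l -> IZR (Mpos x) < y.

(** Mean time from [j] to [j + 1] for the walk on the naturals: the solution of
    [p e_j = 1 + (1 - p) e_(j-1)] with [e_0 = / p]. *)
Definition esc_step (p : R) (j : nat) : R :=
  (/ p + / (1 - 2 * p)) * ((1 - p) / p) ^ j - / (1 - 2 * p).

(** Mean time for the walk on [nat] with rates [p] up and [1 - p] down to reach [j] from [0]. *)
Definition esc (p : R) (j : nat) : R := lsum (seq 0 j) (esc_step p).

Lemma esc_S p j : esc p (S j) = esc p j + esc_step p j.
Proof. unfold esc. rewrite seq_S, lsum_app. simpl. ring. Qed.

Lemma ratio_gt_1 p : 0 < p < 1 / 2 -> 1 < (1 - p) / p.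
Proof.
  intros Hp. apply Rmult_lt_reg_r with p; [lra|]. unfold Rdiv.
  rewrite Rmult_assoc, Rinv_l; lra.
Qed.

Lemma esc_step_pos p j : 0 < p < 1 / 2 -> 0 < esc_step p j.
Proof.
  intros Hp. unfold esc_step.
  assert (0 < / p) by (apply Rinv_0_lt_compat; lra).
  assert (0 < / (1 - 2 * p)) by (apply Rinv_0_lt_compat; lra).
  assert (1 <= ((1 - p) / p) ^ j) by (apply pow_R1_Rle; pose proof (ratio_gt_1 p Hp); lra). nra.
Qed.

Lemma esc_mono p i j : 0 < p < 1 / 2 -> (i <= j)%nat -> esc p i <= esc p j.
Proof.
  intros Hp. induction 1 as [|j Hj IH]; [lra|].
  rewrite esc_S. pose proof (esc_step_pos p j Hp). lra.
Qed.

Lemma esc_nonneg p j : 0 < p < 1 / 2 -> 0 <= esc p j.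
Proof. intros Hp. apply (esc_mono p 0); auto; lia. Qed.

(** The generator of the walk maps [esc] to 1. The convention [pred 0 = 0] encodes the absence of a
    down step at 0. *)
Lemma esc_balance p j : 0 < p < 1 / 2 ->
  p * (esc p (S j) - esc p j) - (1 - p) * (esc p j - esc p (pred j)) = 1.
Proof.
  intros Hp. destruct j as [|j]; cbn [pred]; rewrite !esc_S; unfold esc_step.
  - simpl. field. lra.
  - simpl. field. lra.
Qed.

Lemma esc_upper p : 0 < p < 1 / 2 -> exists C, 0 < C /\ forall j, esc p j <= C * ((1 - p) / p) ^ j.
Proof.
  intros Hp. pose proof (ratio_gt_1 p Hp) as Hr. set (rho := (1 - p) / p) in *.
  assert (0 < / p) by (apply Rinv_0_lt_compat; lra).
  assert (Hi : 0 < / (1 - 2 * p)) by (apply Rinv_0_lt_compat; lra).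
  (* Geometric sum of the leading terms of [esc_step]; the negative constants are dropped. *)
  exists ((/ p + / (1 - 2 * p)) / (rho - 1)). split; [apply Rdiv_lt_0_compat; lra|].
  induction j as [|j IH].
  - unfold esc; simpl. rewrite Rmult_1_r. left; apply Rdiv_lt_0_compat; lra.
  - rewrite esc_S. unfold esc_step. fold rho. eapply Rle_trans; [apply Rplus_le_compat_r, IH|].
    apply Rminus_le_0. replace (_ - _) with (/ (1 - 2 * p)); [lra|].
    simpl. field. lra.
Qed.

Lemma rightmost_low_bound p : 0 < p < 1 / 2 -> exists C, 0 < C /\ forall y J N t,
  y <= INR J -> 0 <= t ->
  GS p (low_event y) N [] Oconf t <= exp (- (C * (p / (1 - p)) ^ J) * t).
Proof.
  intros Hp. destruct (esc_upper p Hp) as [C [HC Hup]]. pose proof (ratio_gt_1 p Hp) as Hr.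
  assert (HC' : 0 < / (C * ((1 - p) / p))) by (apply Rinv_0_lt_compat; nra).
  exists (/ (C * ((1 - p) / p))). split; auto.
  (* The inverse mean time to reach [S J], so that [h'] vanishes at that height and is nonnegative
     below it. *)
  intros y J N t HJ Ht. set (lam := / esc p (S J)).
  assert (HE : 0 < esc p (S J)).
  { rewrite esc_S. pose proof (esc_nonneg p J Hp). pose proof (esc_step_pos p J Hp). lra. }
  assert (Hlam : / (C * ((1 - p) / p)) * (p / (1 - p)) ^ J <= lam).
  { unfold lam. replace (/ (C * ((1 - p) / p)) * (p / (1 - p)) ^ J)
      with (/ (C * ((1 - p) / p) ^ (S J))).
    - apply Rinv_le_contravar; auto.
    - replace (p / (1 - p)) with (/ ((1 - p) / p)) by (field; lra).
      rewrite pow_inv, <- Rinv_mult. f_equal. simpl. ring. }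
  (* The shift by one makes the walk start at 0, as [Mpos Oconf] is -1. *)
  set (j := fun x => Z.to_nat (Mpos x + 1)).
  set (h' := fun x => 1 - lam * esc p (j x)).
  (* From height [y] on the event is lost, and 0 is an admissible value. *)
  set (h := fun x => if Rlt_dec (IZR (Mpos x)) y then h' x else 0).
  assert (Hl0 : 0 < lam) by (apply Rinv_0_lt_compat; auto).
  assert (Hh' : forall x, (j x <= S J)%nat -> 0 <= h' x).
  { intros x Hx. unfold h'. pose proof (esc_mono p _ _ Hp Hx).
    assert (lam * esc p (S J) = 1) by (unfold lam; field; lra). nra. }
  assert (Hhh : forall x, (j x <= S J)%nat -> h x <= h' x).
  { intros x Hx. unfold h. destruct Rlt_dec; [lra|auto]. }
  assert (Hj : forall x, neutral x -> IZR (Mpos x) < y -> (j x <= J)%nat).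
  { intros x Hx Hy. assert (Mpos x < Z.of_nat J)%Z.
    { apply lt_IZR. rewrite <- INR_IZR_INZ. lra. }
    unfold j. lia. }
  assert (Hgoal : GS p (low_event y) N [] Oconf t <= exp (- lam * t) * h Oconf).
  { apply (GS_le_super p neutral); auto using stable_neutral, neutral_O; [lra| |].
    - intros x Hx. unfold h. destruct Rlt_dec; [|lra]. apply Hh'.
      specialize (Hj x Hx r). lia.
    - intros hist x w Hx Hw. destruct (Rlt_dec (IZR (Mpos x)) y) as [Hy|Hy].
      2:{ left. intros l [_ Hl]. apply Hy, Hl. apply in_app_iff. right; left; auto. }
      right. specialize (Hj x Hx Hy).
      assert (Ehx : h x = h' x) by (unfold h; destruct Rlt_dec; tauto). rewrite Ehx. split.
      + destruct (classic (low_event y (rev (x :: hist)))) as [[HO _]|Hn].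
        * unfold EvO in HO. cbn [rev] in HO. rewrite last_last in HO. subst x.
          unfold h', j. rewrite Mpos_O. simpl. unfold esc; simpl.
          eapply Rle_trans; [apply ind_bounds|]. lra.
        * rewrite ind_false by auto. apply Hh'. lia.
      + pose proof (neutral_fin x Hx) as Hf. pose proof (Mpos_neutral x Hx) as HM.
        destruct (Mpos_top x Hf) as [Ht1 Ht2].
        set (M := Mpos x) in *.
        set (up := esc p (S (j x)) - esc p (j x)).
        set (dn := esc p (j x) - esc p (pred (j x))).
        assert (Hdn : 0 <= dn) by (unfold dn; apply Rle_minus_r; rewrite Rplus_0_l; apply esc_mono; auto; lia).
        (* The window is enlarged so as to contain both edges [M] and [M - 1] at which the top
           particle can move. *)
        destruct (win_swap w x M Hw) as (w1 & Hw1 & Hx1 & _ & Hi1 & _).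
        apply In_sites in Hi1.
        set (W := S (S (w1 + w))).
        assert (HWx : win W x) by (apply win_weaken with w; auto; unfold W; lia).
        replace (lsum (sites (S w)) (fun i => rate p x i * h (swap x i))) with
                (lsum (sites (S W)) (fun i => rate p x i * h (swap x i))).
        2:{ rewrite <- !Series_sites with (f := fun i => rate p x i * h (swap x i)); auto;
            intros z Hz; [rewrite (rate_outside p w)|rewrite (rate_outside p W)]; auto; try ring; lia. }
        rewrite (qout_sites p W) by auto.
        apply Rle_trans with (lsum (sites (S W)) (fun i => h' x * rate p x i
           + (if Z.eqb i M then - lam * (p * up) else 0)
           + (if Z.eqb i (M - 1) then lam * ((1 - p) * dn) else 0))).
        * apply lsum_le. intros i _.
          destruct (Z.eqb_spec i M) as [->|Hn1]; [|destruct (Z.eqb_spec i (M - 1)) as [->|Hn2]].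
          -- destruct (Z.eqb_spec M (M - 1)); [lia|].
             assert (Hr1 : rate p x M = p).
             { unfold rate. rewrite Ht1. destruct (x (M + 1)%Z) eqn:E; auto. apply Ht2 in E. lia. }
             assert (Ej : j (swap x M) = S (j x)).
             { unfold j, M. rewrite Mpos_swap_top by auto. fold M. lia. }
             assert (h (swap x M) <= h' (swap x M)) by (apply Hhh; rewrite Ej; lia).
             rewrite Hr1. unfold h' in *. rewrite Ej in *. unfold up.
             assert (p * h (swap x M) <= p * (1 - lam * esc p (S (j x)))) by (apply Rmult_le_compat_l; lra).
             lra.
          -- destruct (x (M - 1)%Z) eqn:E.
             ++ rewrite rate_zero by (rewrite Z.sub_add; congruence).
                assert (0 <= lam * ((1 - p) * dn)) by (apply Rmult_le_pos; [lra|apply Rmult_le_pos; lra]). lra.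
             ++ assert (Hr1 : rate p x (M - 1) = 1 - p).
                { unfold rate. rewrite Z.sub_add, Ht1, E. auto. }
                assert (Hs : neutral (swap x (M - 1))) by (apply neutral_swap; auto).
                assert (Ej : j (swap x (M - 1)) = pred (j x)).
                { apply Mpos_neutral in Hs. unfold j, M in *. rewrite Mpos_swap_below_top in * by auto. lia. }
                assert (h (swap x (M - 1)) <= h' (swap x (M - 1))) by (apply Hhh; rewrite Ej; lia).
                rewrite Hr1. unfold h' in *. rewrite Ej in *. unfold dn.
                assert ((1 - p) * h (swap x (M - 1)) <= (1 - p) * (1 - lam * esc p (pred (j x))))
                  by (apply Rmult_le_compat_l; lra).
                lra.
          -- rewrite !Rplus_0_r, (Rmult_comm (h' x)). apply rate_term_le; [lra|]. intros Hi.
             assert (Ej : j (swap x i) = j x) by (unfold j; rewrite Mpos_swap_other; auto).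
             replace (h' x) with (h' (swap x i)) by (unfold h'; rewrite Ej; auto).
             apply Hhh. lia.
        * rewrite !lsum_plus, lsum_scal.
          rewrite !lsum_delta by (auto using NoDup_sites; apply In_sites; unfold W; lia).
          pose proof (esc_balance p (j x) Hp) as Hb. fold up dn in Hb.
          assert (h' x <= 1).
          { unfold h'. pose proof (esc_nonneg p (j x) Hp).
            assert (0 <= lam * esc p (j x)) by (apply Rmult_le_pos; lra). lra. }
          assert (lam * (p * up) - lam * ((1 - p) * dn) = lam) by (rewrite <- Rmult_minus_distr_l, Hb; ring).
          nra. }
  eapply Rle_trans; [apply Hgoal|].
  assert (Hh1 : 0 <= h Oconf <= 1).
  { unfold h, h', j. rewrite Mpos_O. simpl. unfold esc; simpl. destruct Rlt_dec; lra. }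
  apply Rle_trans with (exp (- lam * t)); [pose proof (exp_pos (- lam * t)); nra|].
  apply exp_monotone. apply Rmult_le_compat_r; lra.
Qed.

(** * The partition function *)

Definition flip (z : Z) (x : conf) : conf := fun y => if Z.eqb y z then negb (x y) else x y.

(** Occupations are chosen freely on [l], without conservation of particles; this is what lets the
    sum of [s ^ area] factor over sites. *)
Fixpoint alls (l : list Z) : list conf :=
  match l with
  | [] => [Oconf]
  | z :: l' => alls l' ++ map (flip z) (alls l')
  end.

Lemma flip_flip z x : flip z (flip z x) = x.
Proof.
  apply functional_extensionality; intros y. unfold flip.
  destruct (Z.eqb_spec y z); auto. apply Bool.negb_involutive.
Qed.

Lemma In_alls l x : In x (alls l) <-> forall z, ~ In z l -> x z = Oconf z.
Proof.
  revert x. induction l as [|a l IH]; intros x; cbn [alls].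
  - split.
    + intros [<-|[]] z _; auto.
    + intros H. left. apply functional_extensionality. intros z. symmetry. apply H. auto.
  - rewrite in_app_iff, IH, in_map_iff. split.
    + intros [H|[y [<- Hy]]] z Hz; [apply H; intros Hc; apply Hz; right; auto|].
      unfold flip. destruct (Z.eqb_spec z a) as [->|]; [exfalso; apply Hz; left; auto|].
      apply IH with (z := z) in Hy; auto. intros Hc; apply Hz; right; auto.
    + intros H. destruct (Bool.bool_dec (x a) (Oconf a)) as [E|E].
      * left. intros z Hz. destruct (Z.eq_dec z a) as [->|]; auto.
        apply H. intros [->|Hc]; auto.
      * right. exists (flip a x). split; [apply flip_flip|]. apply IH. intros z Hz.
        unfold flip. destruct (Z.eqb_spec z a) as [->|].
        -- destruct (x a), (Oconf a); simpl; congruence.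
        -- apply H. intros [->|Hc]; auto.
Qed.

Lemma NoDup_alls l : NoDup l -> NoDup (alls l).
Proof.
  induction 1 as [|a l Ha Hl IH]; cbn [alls].
  - constructor; [intros []|constructor].
  - apply NoDup_app; auto.
    + apply FinFun.Injective_map_NoDup; auto. intros x y Hxy.
      rewrite <- (flip_flip a x), Hxy. apply flip_flip.
    + intros x Hx Hx'. apply in_map_iff in Hx' as [y [<- Hy]].
      rewrite In_alls in Hx, Hy. specialize (Hx a Ha). specialize (Hy a Ha).
      unfold flip in Hx. rewrite Z.eqb_refl in Hx. rewrite Hy in Hx.
      destruct (Oconf a); discriminate.
Qed.

Lemma In_alls_sites w x : In x (alls (sites w)) <-> win w x.
Proof.
  rewrite In_alls. split.
  - intros H z Hz. apply H. rewrite In_sites. lia.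
  - intros H z Hz. apply H. rewrite In_sites in Hz. lia.
Qed.

Lemma area_flip x z : fin x -> x z = Oconf z ->
  area (flip z x) = (area x + Z.abs_nat z)%nat.
Proof.
  intros [w H] Hz. set (W := (w + Z.abs_nat z + 1)%nat).
  assert (H1 : win W x) by (apply win_weaken with w; auto; unfold W; lia).
  assert (H2 : win W (flip z x)).
  { intros y Hy. unfold flip. destruct (Z.eqb_spec y z); [unfold W in Hy; lia|]. apply H1; auto. }
  apply Nat2Z.inj. rewrite Nat2Z.inj_add, Zabs2Nat.id_abs, !(area_win W) by auto.
  rewrite <- (zsum_delta (sites W) z (Z.abs z)) by (apply NoDup_sites || (apply In_sites; unfold W; lia)).
  rewrite <- zsum_plus. apply zsum_ext. intros y _.
  destruct (Z.eqb_spec y z) as [->|Hn].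
  - rewrite dev_term_abs.
    + unfold dev. rewrite Hz. lia.
    + unfold flip. rewrite Z.eqb_refl, Hz. destruct (Oconf z); discriminate.
  - unfold dev, flip. destruct (Z.eqb_spec y z); [tauto|lia].
Qed.

Lemma alls_fin l x : In x (alls l) -> fin x.
Proof.
  rewrite In_alls. intros H. exists (fold_right (fun z n => (S (Z.abs_nat z) + n)%nat) 0%nat l).
  intros z Hz. apply H. intros Hl.
  assert (S (Z.abs_nat z) <= fold_right (fun z n => (S (Z.abs_nat z) + n)%nat) 0%nat l)%nat.
  { clear H Hz. induction l as [|a l IH]; simpl in *; [tauto|].
    destruct Hl as [->|Hl]; [lia|]. specialize (IH Hl). lia. }
  lia.
Qed.

(** Flipping the site [z] multiplies the weight by [s ^ |z|], so each site contributes a factor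
    [1 + s ^ |z| <= exp (s ^ |z|)]. *)
Lemma partition_le_exp s l : 0 < s -> NoDup l ->
  lsum (alls l) (fun x => s ^ area x) <= exp (lsum l (fun z => s ^ Z.abs_nat z)).
Proof.
  intros Hs. induction 1 as [|a l Ha Hl IH].
  - simpl. rewrite area_O, exp_0. simpl. lra.
  - cbn [alls]. rewrite lsum_app, lsum_map.
    rewrite (lsum_ext (alls l) (fun b => s ^ area (flip a b)) (fun b => s ^ Z.abs_nat a * s ^ area b)).
    2:{ intros b Hb. rewrite area_flip.
        - rewrite pow_add. ring.
        - apply alls_fin with l; auto.
        - rewrite In_alls in Hb. auto. }
    rewrite lsum_scal. cbn [lsum fold_right]. rewrite exp_plus.
    fold (lsum l (fun z => s ^ Z.abs_nat z)).
    pose proof (exp_ineq1_le (s ^ Z.abs_nat a)).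
    assert (0 < s ^ Z.abs_nat a) by (apply pow_lt; auto).
    assert (0 <= lsum (alls l) (fun x => s ^ area x))
      by (apply lsum_nonneg; intros; left; apply pow_lt; auto).
    set (A := lsum (alls l) (fun x => s ^ area x)) in *.
    apply Rle_trans with ((1 + s ^ Z.abs_nat a) * A); [lra|].
    apply Rmult_le_compat; lra.
Qed.

Lemma lsum_sites_pow s w : 0 < s < 1 -> lsum (sites w) (fun z => s ^ Z.abs_nat z) <= 2 / (1 - s).
Proof.
  (* The sites [w] and [- w - 1] contribute at most [s ^ w] each, so a partial geometric sum with
     factor 2 passes through the induction. *)
  intros Hs. assert (H : lsum (sites w) (fun z => s ^ Z.abs_nat z) <= 2 * (1 - s ^ w) / (1 - s)).
  { induction w as [|w IH]; [simpl; right; field; lra|].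
    cbn [sites]. rewrite lsum_app. cbn [lsum fold_right].
    replace (Z.abs_nat (Z.of_nat w)) with w by lia.
    replace (Z.abs_nat (- Z.of_nat w - 1)) with (S w) by lia.
    fold (lsum (sites w) (fun z => s ^ Z.abs_nat z)).
    assert (s ^ S w <= s ^ w) by (simpl; assert (0 < s ^ w) by (apply pow_lt; lra); nra).
    replace (2 * (1 - s ^ S w) / (1 - s)) with (2 * (1 - s ^ w) / (1 - s) + 2 * s ^ w)
      by (simpl; field; lra).
    lra. }
  eapply Rle_trans; [apply H|]. apply Rmult_le_compat_r; [left; apply Rinv_0_lt_compat; lra|].
  assert (0 < s ^ w) by (apply pow_lt; lra). lra.
Qed.

Definition Zbound (s : R) : R := exp (2 / (1 - s)).

Lemma partition_le s w : 0 < s < 1 ->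
  lsum (alls (sites w)) (fun x => s ^ area x) <= Zbound s.
Proof.
  intros Hs. eapply Rle_trans; [apply partition_le_exp; [lra|apply NoDup_sites]|].
  apply exp_monotone, lsum_sites_pow; auto.
Qed.

(** * The chain killed when the displacement reaches [m] *)

Definition below (m : nat) (x : conf) : Prop := fin x /\ (area x < m)%nat.

Definition stay_event (m : nat) (f : conf -> Prop) (l : list conf) : Prop :=
  Forall (below m) l /\ f (last l Oconf).

(** Two sites wider than [m], so that it is invariant under the swaps across all edges of
    [sites (S m)] used in [gen]. *)
Definition box (m : nat) : list conf := alls (sites (S (S m))).

(** The off-diagonal part of the generator; its edges include every possible jump from a state below
    [m]. *)
Definition gen (p : R) (m : nat) (f : conf -> R) (x : conf) : R :=
  lsum (sites (S m)) (fun i => rate p x i * f (swap x i)).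

Definition chi (m : nat) (x : conf) : R := ind (below m x).

Definition maxrate (m : nat) : R := INR (2 * S m).

Definition wt (p : R) (x : conf) : R := (p / (1 - p)) ^ area x.

Lemma wt_pos p x : 0 < p < 1 -> 0 < wt p x.
Proof. intros Hp. apply pow_lt. apply Rdiv_lt_0_compat; lra. Qed.

Lemma wt_O p : wt p Oconf = 1.
Proof. unfold wt. rewrite area_O. auto. Qed.

Lemma box_fin m x : In x (box m) -> fin x.
Proof. apply alls_fin. Qed.

Lemma O_in_box m : In Oconf (box m).
Proof. apply In_alls_sites, win_O. Qed.

Lemma detailed_balance p x i : 0 < p < 1 -> fin x ->
  wt p (swap x i) * rate p (swap x i) i = wt p x * rate p x i.
Proof.
  intros Hp Hf. unfold wt. destruct (x i) eqn:E1, (x (i + 1)%Z) eqn:E2.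
  - rewrite !rate_zero by (rewrite ?swap_l, ?swap_r; congruence). ring.
  - rewrite area_swap_right by auto. unfold rate. rewrite swap_l, swap_r, E1, E2. simpl. field. lra.
  - rewrite (area_swap_left x i) by auto. unfold rate. rewrite swap_l, swap_r, E1, E2. simpl. field. lra.
  - rewrite !rate_zero by (rewrite ?swap_l, ?swap_r; congruence). ring.
Qed.

(** For each edge the swap is an involution that permutes [box m]; reindexing by it and using
    detailed balance exchanges [f] and [g]. *)
Lemma gen_self_adjoint p m f g : 0 < p < 1 ->
  lsum (box m) (fun x => wt p x * (g x * gen p m f x)) =
  lsum (box m) (fun x => wt p x * (f x * gen p m g x)).
Proof.
  intros Hp. unfold gen.
  assert (He : forall f g, lsum (box m) (fun x => wt p x * (g x *
       lsum (sites (S m)) (fun i => rate p x i * f (swap x i)))) =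
     lsum (sites (S m)) (fun i => lsum (box m) (fun x => wt p x * rate p x i * (g x * f (swap x i))))).
  { intros f' g'. rewrite <- lsum_exchange. apply lsum_ext. intros x _.
    rewrite <- !lsum_scal. apply lsum_ext. intros; ring. }
  rewrite !He. apply lsum_ext. intros i Hi. apply In_sites in Hi.
  set (F := fun x => wt p x * rate p x i * (g x * f (swap x i))).
  rewrite <- (lsum_perm (map (fun x => swap x i) (box m)) (box m)).
  - rewrite lsum_map. apply lsum_ext. intros x Hx. unfold F. cbv beta.
    rewrite swap_swap, detailed_balance by eauto using box_fin. ring.
  - apply NoDup_Permutation.
    + apply FinFun.Injective_map_NoDup; [|apply NoDup_alls, NoDup_sites].
      intros x y Hxy. rewrite <- (swap_swap x i), Hxy. apply swap_swap.
    + apply NoDup_alls, NoDup_sites.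
    + intros x. rewrite in_map_iff. unfold box. split.
      * intros [y [<- Hy]]. rewrite In_alls_sites in *. apply win_swap_inside; auto; lia.
      * intros Hx. exists (swap x i). split; [apply swap_swap|].
        rewrite In_alls_sites in *. apply win_swap_inside; auto; lia.
Qed.

Lemma gen_le p m f x c : 0 < p < 1 -> (forall y, f y <= c) -> 0 <= c ->
  gen p m f x <= maxrate m * c.
Proof.
  intros Hp Hf Hc. unfold gen, maxrate. rewrite <- length_sites, <- lsum_const.
  apply lsum_le. intros i _. pose proof (rate_bounds p x i Hp). specialize (Hf (swap x i)). nra.
Qed.

Lemma gen_nonneg p m f x : 0 < p < 1 -> (forall y, 0 <= f y) -> 0 <= gen p m f x.
Proof.
  intros Hp Hf. apply lsum_nonneg. intros i _. apply Rmult_le_pos; auto. apply rate_bounds; auto.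
Qed.

Lemma below_win m x : below m x -> win m x.
Proof. intros [H1 H2]. apply area_lt_win; auto. Qed.

Lemma stay_out p m f n hist x t : ~ below m x -> G p (stay_event m f) n hist x t = 0.
Proof.
  intros H. apply G_zero. intros l [Hl _]. apply H.
  rewrite Forall_forall in Hl. apply Hl. apply in_app_iff. right; left; auto.
Qed.

Lemma stay_sum_out p m f N hist x t : ~ below m x -> GS p (stay_event m f) N hist x t = 0.
Proof.
  intros H. unfold GS. rewrite sum_n_lsum. apply lsum_zero. intros. apply stay_out; auto.
Qed.

Lemma stay_forget p m f n x y t : below m x ->
  G p (stay_event m f) n [x] y t = G p (stay_event m f) n [] y t.
Proof.
  intros H. apply G_ext. intros l. cbn [rev app]. unfold stay_event.
  change (last (x :: y :: l) Oconf) with (last (y :: l) Oconf).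
  split; intros [H1 H2]; split; auto. inversion H1; auto.
Qed.

Lemma stay_nonneg p m f n x t : 0 < p < 1 -> 0 <= t -> 0 <= G p (stay_event m f) n [] x t.
Proof.
  intros Hp Ht. destruct (classic (below m x)) as [H|H].
  - apply G_nonneg; auto. apply H.
  - rewrite stay_out by auto. lra.
Qed.

Lemma stay_sum_bounds p m f N x t : 0 < p < 1 -> 0 <= t ->
  0 <= GS p (stay_event m f) N [] x t <= chi m x.
Proof.
  intros Hp Ht. unfold chi. destruct (classic (below m x)) as [H|H].
  - rewrite ind_true by auto. split; [apply GS_nonneg|apply GS_le_1]; auto; apply H.
  - rewrite stay_sum_out, ind_false by auto. lra.
Qed.

Lemma is_derive_stay p m f n x t : below m x ->
  is_derive (G p (stay_event m f) (S n) [] x) t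
    (- qout p x * G p (stay_event m f) (S n) [] x t
     + gen p m (fun y => G p (stay_event m f) n [] y t) x).
Proof.
  intros H. evar_last; [apply is_derive_G_S, (below_win m); auto|].
  f_equal. apply (lsum_ext (sites (S m))). intros i _. rewrite stay_forget; auto.
Qed.

(** The factor [chi] makes the equation valid at every state: outside the region the function is
    identically zero. *)
Lemma is_derive_stay_sum p m f N x t :
  is_derive (GS p (stay_event m f) (S N) [] x) t
    (chi m x * (- qout p x * GS p (stay_event m f) (S N) [] x t
     + gen p m (fun y => GS p (stay_event m f) N [] y t) x)).
Proof.
  unfold chi. destruct (classic (below m x)) as [H|H].
  - rewrite ind_true, Rmult_1_l by auto. evar_last; [apply is_derive_GS_S, (below_win m); auto|].
    f_equal. apply (lsum_ext (sites (S m))). intros i _. f_equal.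
    unfold GS. apply sum_n_ext. intros n. apply stay_forget; auto.
  - rewrite ind_false, Rmult_0_l by auto.
    apply (is_derive_ext (fun _ => 0)); [intros; rewrite stay_sum_out; auto|].
    apply (is_derive_const (K := R_AbsRing) (V := R_NormedModule) 0).
Qed.

(** * Poisson-type bound on the number of jumps of the killed chain *)

Definition tail_bound (m N : nat) (t : R) : R := (maxrate m * t) ^ N / INR (fact N).

Lemma maxrate_pos m : 0 < maxrate m.
Proof. apply lt_0_INR. lia. Qed.

Lemma tail_bound_mono m N s t : 0 <= s <= t -> tail_bound m N s <= tail_bound m N t.
Proof.
  intros Hs. pose proof (maxrate_pos m). apply Rmult_le_compat_r.
  - left. apply Rinv_0_lt_compat, lt_0_INR, lt_O_fact.
  - apply pow_incr. split; [apply Rmult_le_pos; lra|apply Rmult_le_compat_l; lra].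
Qed.

Lemma tail_bound_nonneg m N t : 0 <= t -> 0 <= tail_bound m N t.
Proof.
  intros Ht. pose proof (maxrate_pos m). apply Rmult_le_pos.
  - apply pow_le, Rmult_le_pos; lra.
  - left. apply Rinv_0_lt_compat, lt_0_INR, lt_O_fact.
Qed.

Lemma tail_bound_lim m t : is_lim_seq (fun N => tail_bound m N t) 0.
Proof. apply is_lim_seq_Reals. apply cv_speed_pow_fact. Qed.

Lemma is_derive_tail_bound m n s :
  is_derive (tail_bound m (S n)) s (maxrate m * tail_bound m n s).
Proof.
  unfold tail_bound.
  replace (INR (fact (S n))) with (INR (S n) * INR (fact n))
    by (rewrite fact_simpl, mult_INR; auto).
  assert (INR (fact n) <> 0) by apply INR_fact_neq_0.
  assert (INR (S n) <> 0) by (apply not_0_INR; auto).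
  evar_last.
  - apply (is_derive_scal_l (V := R_NormedModule) (fun s => (maxrate m * s) ^ S n) s).
    apply (is_derive_pow (fun s => maxrate m * s) (S n) s (maxrate m)). auto_derive; auto. ring.
  - unfold scal; cbn [Nat.pred]; simpl. unfold mult; simpl.
    change (match n with O => 1 | S _ => INR n + 1 end) with (INR (S n)). field. auto.
Qed.

(** The bound satisfies the recursion of [G] with the exit rate removed and the total inflow
    replaced by its maximum [maxrate m]. *)
Lemma stay_tail p m f n x t : 0 < p < 1 -> 0 <= t ->
  G p (stay_event m f) n [] x t <= tail_bound m n t.
Proof.
  intros Hp. revert x t. induction n as [|n IH]; intros x t Ht;
  (destruct (classic (below m x)) as [H|H];
    [|rewrite stay_out by auto; apply tail_bound_nonneg; auto]).
  - unfold tail_bound. simpl. unfold Rdiv. rewrite Rinv_1, Rmult_1_r.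
    pose proof (stay_sum_bounds p m f 0 x t Hp Ht). rewrite GS_0 in H0.
    unfold chi in H0. pose proof (ind_bounds (below m x)). cbn [G] in H0. simpl in H0. lra.
  - apply Rminus_le_0.
    apply (ode_nonneg (qout p x) (fun t => tail_bound m (S n) t - G p (stay_event m f) (S n) [] x t)
     (fun t => qout p x * tail_bound m (S n) t + (maxrate m * tail_bound m n t
         - gen p m (fun y => G p (stay_event m f) n [] y t) x))); auto.
    + intros s. evar_last.
      * apply (is_derive_minus (K := R_AbsRing) (V := R_NormedModule)); [|apply is_derive_stay; auto].
        apply is_derive_tail_bound.
      * unfold minus, plus, opp; simpl. ring.
    + intros s Hs. apply Rplus_le_le_0_compat.
      * apply Rmult_le_pos; [apply qout_nonneg; auto; apply H|apply tail_bound_nonneg; lra].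
      * apply Rle_minus_r. rewrite Rplus_0_l. apply gen_le; auto.
        -- intros y. apply IH. lra.
        -- apply tail_bound_nonneg; lra.
    + rewrite G_S_at_0 by apply H. rewrite Rminus_0_r. apply tail_bound_nonneg. lra.
Qed.

(** * Loss of weighted mass through the level [m] *)

Definition flux (p : R) (m : nat) : R :=
  maxrate m * lsum (box m) (fun x => wt p x * ind (S (area x) = m)).

(** The left side is the rate of jumps out of the region. As a jump changes the area by one, they
    start at area [m - 1]; summing over the weights gives [flux]. *)
Lemma boundary_rate p m x : 0 < p < 1 -> below m x ->
  qout p x - gen p m (chi m) x <= maxrate m * ind (S (area x) = m).
Proof.
  intros Hp H. rewrite (qout_sites p m) by (apply below_win; auto).
  unfold gen. rewrite <- lsum_minus. unfold maxrate. rewrite <- length_sites, <- lsum_const.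
  apply lsum_le. intros i _. pose proof (rate_bounds p x i Hp). unfold chi.
  destruct (Bool.bool_dec (x i) (x (i + 1)%Z)) as [E|E].
  - rewrite rate_zero by auto. pose proof (ind_bounds (S (area x) = m)). lra.
  - destruct (classic (below m (swap x i))) as [H'|H'].
    + rewrite ind_true by auto. pose proof (ind_bounds (S (area x) = m)). lra.
    + rewrite ind_false by auto. rewrite ind_true; [lra|].
      destruct H as [Hf Hm]. pose proof (area_swap x i Hf).
      assert (~ (area (swap x i) < m)%nat) by (intros Hc; apply H'; split; auto; apply fin_swap; auto).
      destruct (x i), (x (i + 1)%Z); simpl in *; try congruence; lia.
Qed.

Lemma gen_chi_bounds p m x : 0 < p < 1 -> 0 <= gen p m (chi m) x <= maxrate m.
Proof.
  intros Hp. split.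
  - apply gen_nonneg; auto. intros; apply ind_bounds.
  - rewrite <- (Rmult_1_r (maxrate m)). apply gen_le; auto; [|lra]. intros; apply ind_bounds.
Qed.

Definition mass (p : R) (m : nat) (f : conf -> R) : R := lsum (box m) (fun x => wt p x * f x).

Definition Zbox (p : R) (m : nat) : R := lsum (box m) (wt p).

(** Reversibility: the weighted mass of the killed chain only leaks through the boundary. *)
Lemma mass_lower p m f N t : 0 < p < 1 -> 0 <= t ->
  mass p m (fun x => chi m x * ind (f x))
    - t * (flux p m + maxrate m * tail_bound m (S N) t * Zbox p m)
  <= mass p m (fun x => GS p (stay_event m f) (S N) [] x t).
Proof.
  intros Hp Ht. set (U := fun N x t => GS p (stay_event m f) N [] x t).
  replace (mass p m (fun x => chi m x * ind (f x))) with (mass p m (fun x => U (S N) x 0)).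
  2:{ apply lsum_ext. intros x Hx. f_equal. unfold U, chi.
      rewrite GS_S_at_0 by eauto using box_fin. cbn [rev app].
      destruct (classic (below m x)) as [H|H].
      - rewrite (ind_true (below m x)), Rmult_1_l by auto. apply ind_ext.
        unfold stay_event. simpl. split; [tauto|]. intros; split; auto.
      - rewrite (ind_false (below m x)) by auto. rewrite ind_false; [ring|].
        intros [Hc _]. inversion Hc; auto. }
  unfold Rminus. rewrite (Rmult_comm t), Ropp_mult_distr_l.
  apply (derive_lower_bound (fun t => mass p m (fun x => U (S N) x t))
     (fun t => lsum (box m) (fun x => wt p x * (chi m x * (- qout p x * U (S N) x t
       + gen p m (fun y => U N y t) x))))); auto.
  - intros s. apply is_derive_lsum. intros x _.
    apply is_derive_scal. apply is_derive_stay_sum.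
  - intros s Hs.
    (* Self-adjointness moves [gen] onto [chi m], leaving the boundary rate times [U], up to the
       term with exactly [S N] jumps. *)
    rewrite (lsum_ext _ _ (fun x => wt p x * (- chi m x * qout p x * U (S N) x s)
       + wt p x * (chi m x * gen p m (fun y => U N y s) x))) by (intros; ring).
    rewrite lsum_plus, gen_self_adjoint, <- lsum_plus by auto.
    unfold flux, Zbox. rewrite <- !lsum_scal, <- lsum_plus.
    rewrite <- (Rmult_1_l (lsum _ _)), Ropp_mult_distr_l, <- lsum_scal.
    apply lsum_le. intros x _.
    assert (EU : U (S N) x s = U N x s + G p (stay_event m f) (S N) [] x s) by apply GS_S.
    assert (Hg : 0 <= G p (stay_event m f) (S N) [] x s) by (apply stay_nonneg; auto; lra).
    assert (Hg' : G p (stay_event m f) (S N) [] x s <= tail_bound m (S N) t).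
    { eapply Rle_trans; [apply stay_tail; auto; lra|apply tail_bound_mono; auto]. }
    assert (HU : 0 <= U (S N) x s <= chi m x) by (apply stay_sum_bounds; auto; lra).
    pose proof (gen_chi_bounds p m x Hp) as Hc. pose proof (wt_pos p x Hp) as Hw.
    pose proof (ind_bounds (S (area x) = m)) as Hi. pose proof (maxrate_pos m) as HC.
    set (u := G p (stay_event m f) (S N) [] x s) in *.
    set (c := gen p m (chi m) x) in *. set (e := tail_bound m (S N) t) in *.
    assert (Huc : u * c <= maxrate m * e).
    { rewrite (Rmult_comm (maxrate m)). apply Rmult_le_compat; lra. }
    assert (Hb : chi m x * qout p x * U (S N) x s - c * U (S N) x s <= maxrate m * ind (S (area x) = m)).
    { pose proof (boundary_rate p m x Hp) as Hbr. fold c in Hbr. clearbody c.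
      unfold chi in *. destruct (classic (below m x)) as [H|H].
      - rewrite (ind_true (below m x)) in * by auto. specialize (Hbr H). rewrite Rmult_1_l, <- Rmult_minus_distr_r.
        assert (0 <= maxrate m * ind (S (area x) = m)) by (apply Rmult_le_pos; lra).
        apply Rle_trans with (maxrate m * ind (S (area x) = m) * U (S N) x s).
        + apply Rmult_le_compat_r; lra.
        + rewrite <- (Rmult_1_r (maxrate m * ind (S (area x) = m))) at 2.
          apply Rmult_le_compat_l; lra.
      - rewrite (ind_false (below m x)) in * by auto.
        replace (U (S N) x s) with 0 by lra. rewrite !Rmult_0_r, Rminus_0_r. apply Rmult_le_pos; lra. }
    replace (U N x s) with (U (S N) x s - u) by lra.
    replace (- (1) * (maxrate m * (wt p x * ind (S (area x) = m)) + maxrate m * e * wt p x)) with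
       (wt p x * (- (maxrate m * ind (S (area x) = m) + maxrate m * e))) by ring.
    rewrite <- (Rmult_plus_distr_l (wt p x) (_ * _ * _)). apply Rmult_le_compat_l; lra.
Qed.

(** * Lower bound for the return probability *)

Lemma lsum_single {A} (l : list A) (f : A -> R) a : NoDup l -> In a l ->
  (forall b, b <> a -> f b = 0) -> lsum l f = f a.
Proof.
  induction 1 as [|b l Hb Hl IH]; intros Hi Hf; [destruct Hi|]. simpl.
  destruct Hi as [->|Hi].
  - rewrite lsum_zero; [ring|]. intros c Hc. apply Hf. intros ->; auto.
  - rewrite IH, (Hf b) by (auto; intros ->; auto). ring.
Qed.

Lemma below_O m : (0 < m)%nat -> below m Oconf.
Proof. intros Hm. split; [apply fin_O|rewrite area_O; auto]. Qed.

(** By reversibility [s |-> <U s, U (2 t - s)>] is constant, up to the truncation error. *)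
Lemma return_ge_square p m N t : 0 < p < 1 -> 0 <= t ->
  mass p m (fun x => (GS p (stay_event m (eq Oconf)) (S N) [] x t) ^ 2)
    - t * (maxrate m * tail_bound m (S N) (2 * t) * Zbox p m)
  <= GS p (stay_event m (eq Oconf)) (S N) [] Oconf (2 * t).
Proof.
  intros Hp Ht. set (U := fun N x t => GS p (stay_event m (eq Oconf)) N [] x t).
  set (phi := fun s => mass p m (fun x => U (S N) x s * U (S N) x (2 * t - s))).
  (* At time 0 the function [U] is concentrated on [Oconf], which has weight 1. *)
  assert (H0 : phi 0 <= U (S N) Oconf (2 * t)).
  { unfold phi, mass. rewrite (lsum_single (box m) _ Oconf).
    - rewrite wt_O, Rminus_0_r, Rmult_1_l.
      assert (0 <= U (S N) Oconf 0 <= chi m Oconf) by (apply stay_sum_bounds; auto; lra).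
      assert (0 <= U (S N) Oconf (2 * t)) by (apply stay_sum_bounds; auto; lra).
      pose proof (ind_bounds (below m Oconf)). unfold chi in *. nra.
    - apply NoDup_alls, NoDup_sites.
    - apply O_in_box.
    - intros x Hx. replace (U (S N) x 0) with 0; [ring|].
      unfold U. destruct (classic (below m x)) as [H|H].
      + rewrite GS_S_at_0 by apply H. rewrite ind_false; auto. intros [_ Hc]. simpl in Hc. congruence.
      + rewrite stay_sum_out; auto. }
  assert (Ht' : phi t = mass p m (fun x => U (S N) x t ^ 2)).
  { apply lsum_ext. intros x _. replace (2 * t - t) with t by ring. simpl. ring. }
  change (mass p m (fun x => GS p (stay_event m (eq Oconf)) (S N) [] x t ^ 2)) with
    (mass p m (fun x => U (S N) x t ^ 2)). rewrite <- Ht'.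
  change (GS p (stay_event m (eq Oconf)) (S N) [] Oconf (2 * t)) with (U (S N) Oconf (2 * t)).
  (* [derive_lower_bound] bounds from below, hence the passage to [- phi]. *)
  enough (H : - phi 0 + - (maxrate m * tail_bound m (S N) (2 * t) * Zbox p m) * t <= - phi t) by lra.
  set (dU := fun x s => chi m x * (- qout p x * U (S N) x s + gen p m (fun y => U N y s) x)).
  apply (derive_lower_bound (fun s => - phi s)
    (fun s => - lsum (box m) (fun x => wt p x *
        (dU x s * U (S N) x (2 * t - s) - U (S N) x s * dU x (2 * t - s))))); auto.
  - intros s. apply (is_derive_opp phi s). apply is_derive_lsum. intros x _. apply is_derive_scal.
    evar_last.
    + apply (is_derive_mult (U (S N) x) (fun s => U (S N) x (2 * t - s)) s (dU x s) (- dU x (2 * t - s))).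
      * apply is_derive_stay_sum.
      * evar_last.
        -- apply (is_derive_comp (U (S N) x) (fun s => 2 * t - s) s (dU x (2 * t - s)) (-1)).
           ++ apply is_derive_stay_sum.
           ++ assert (Hd : is_derive (fun s : R => 2 * t - s) s (-1)) by (auto_derive; auto; ring).
              exact Hd.
        -- unfold scal; simpl. unfold mult; simpl. ring.
      * intros; apply Rmult_comm.
    + unfold plus, mult; simpl. ring.
  - intros s Hs. apply Ropp_le_contravar. unfold Zbox. rewrite <- lsum_scal.
    assert (EU : forall x s, U (S N) x s = U N x s + G p (stay_event m (eq Oconf)) (S N) [] x s)
      by (intros; apply GS_S).
    set (u := fun x s => G p (stay_event m (eq Oconf)) (S N) [] x s) in *.
    assert (EC : forall x s, 0 <= s -> chi m x * U (S N) x s = U (S N) x s).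
    { intros x s' Hs'. unfold chi, U. destruct (classic (below m x)).
      - rewrite ind_true by auto. ring.
      - rewrite stay_sum_out by auto. ring. }
    (* With [U (S N) = U N + u] the two main terms cancel by self-adjointness; only terms containing
       [u] remain. *)
    rewrite (lsum_ext _ _ (fun x =>
       (wt p x * (U N x (2 * t - s) * gen p m (fun y => U N y s) x)
        - wt p x * (U N x s * gen p m (fun y => U N y (2 * t - s)) x)) +
       wt p x * (u x (2 * t - s) * gen p m (fun y => U N y s) x
          - u x s * gen p m (fun y => U N y (2 * t - s)) x))).
    2:{ intros x _. unfold dU.
        transitivity (wt p x * ((chi m x * U (S N) x (2 * t - s)) * gen p m (fun y => U N y s) x
          - (chi m x * U (S N) x s) * gen p m (fun y => U N y (2 * t - s)) x)); [ring|].
        rewrite !EC, !EU by lra. fold (u x (2 * t - s)) (u x s). ring. }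
    rewrite lsum_plus, lsum_minus, gen_self_adjoint by auto.
    rewrite Rminus_diag, Rplus_0_l.
    apply lsum_le. intros x _. pose proof (wt_pos p x Hp).
    rewrite (Rmult_comm (_ * _) (wt p x)). apply Rmult_le_compat_l; [lra|].
    assert (HUN : forall s y, 0 <= s -> 0 <= U N y s <= 1).
    { intros s' y Hs'. pose proof (stay_sum_bounds p m (eq Oconf) N y s' Hp Hs').
      pose proof (ind_bounds (below m y)). unfold chi, U in *. lra. }
    assert (0 <= u x s) by (apply stay_nonneg; auto; lra).
    assert (0 <= u x (2 * t - s)) by (apply stay_nonneg; auto; lra).
    assert (u x (2 * t - s) <= tail_bound m (S N) (2 * t)).
    { eapply Rle_trans; [apply stay_tail; auto; lra|apply tail_bound_mono; lra]. }
    assert (0 <= gen p m (fun y => U N y (2 * t - s)) x)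
      by (apply gen_nonneg; auto; intros; apply HUN; lra).
    assert (0 <= gen p m (fun y => U N y s) x) by (apply gen_nonneg; auto; intros; apply HUN; lra).
    assert (gen p m (fun y => U N y s) x <= maxrate m * 1)
      by (apply gen_le; auto; [intros; apply HUN; lra|lra]).
    assert (0 <= u x s * gen p m (fun y => U N y (2 * t - s)) x) by (apply Rmult_le_pos; auto).
    assert (u x (2 * t - s) * gen p m (fun y => U N y s) x <= tail_bound m (S N) (2 * t) * maxrate m)
      by (apply Rmult_le_compat; lra).
    lra.
Qed.

Lemma is_lim_seq_affine (a b : R) (u : nat -> R) : is_lim_seq u 0 ->
  is_lim_seq (fun N => a - b * u N) a.
Proof.
  intros H. evar_last.
  - apply is_lim_seq_minus'; [apply is_lim_seq_const|].
    apply is_lim_seq_mult'; [apply is_lim_seq_const|apply H].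
  - f_equal. ring.
Qed.

Lemma Zbox_le p m : 0 < p < 1 / 2 -> Zbox p m <= Zbound (p / (1 - p)).
Proof.
  intros Hp. apply partition_le. split; [apply Rdiv_lt_0_compat; lra|].
  apply Rmult_lt_reg_r with (1 - p); [lra|]. unfold Rdiv. rewrite Rmult_assoc, Rinv_l; lra.
Qed.

Lemma Zbox_nonneg p m : 0 < p < 1 -> 0 <= Zbox p m.
Proof. intros Hp. apply lsum_nonneg. intros; left; apply wt_pos; auto. Qed.

(** At half time, [<U, 1>] is at least [1 - (t / 2) flux] up to truncation, and
    [<U, U> >= (2 <U, 1> - 1) / Zb]. This linearised Cauchy-Schwarz inequality avoids a square and
    yields [(1 - t flux) / Zb] as [N] grows. *)
Lemma return_lower p m t : 0 < p < 1 / 2 -> (0 < m)%nat -> 0 <= t ->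
  (1 - t * flux p m) / Zbound (p / (1 - p)) <= Prob p EvO t.
Proof.
  intros Hp Hm Ht. assert (Hp1 : 0 < p < 1) by lra.
  pose proof (Zbox_le p m Hp) as HZ. pose proof (Zbox_nonneg p m Hp1) as HZ0.
  set (Zb := Zbound (p / (1 - p))) in *. assert (HZb : 0 < Zb) by apply exp_pos.
  set (C := maxrate m). pose proof (maxrate_pos m) as HC. fold C in HC.
  set (A := C * Zbox p m).
  assert (HA : 0 <= A) by (apply Rmult_le_pos; lra).
  (* The truncation errors of [mass_lower], multiplied by [2 / Zb], and of [return_ge_square]. *)
  set (b := 2 / Zb * (t / 2) * A + t / 2 * A).
  apply (is_lim_seq_le (fun N => (1 - t * flux p m) / Zb - b * tail_bound m (S N) t)
     (fun N => GS p EvO (S N) [] Oconf t) ((1 - t * flux p m) / Zb) (Prob p EvO t)).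
  2:{ apply is_lim_seq_affine. apply (is_lim_seq_incr_1 (fun N => tail_bound m N t)).
      apply tail_bound_lim. }
  2:{ apply (is_lim_seq_incr_1 (fun N => GS p EvO N [] Oconf t)). apply Prob_lim; auto. }
  intros N. apply Rle_trans with (GS p (stay_event m (eq Oconf)) (S N) [] Oconf t).
  2:{ unfold GS. rewrite !sum_n_lsum. apply lsum_le. intros n _.
      pose proof (G_linear p fin [(1, EvO); (-1, stay_event m (eq Oconf))] n [] Oconf t Hp1 stable_fin) as H.
      simpl in H. enough (0 <= 1 * G p EvO n [] Oconf t + (-1 * G p (stay_event m (eq Oconf)) n [] Oconf t + 0)) by lra.
      apply H; auto using fin_O. intros l _.
      destruct (classic (stay_event m (eq Oconf) l)) as [H'|H'].
      - rewrite !ind_true; auto; [lra|]. destruct H' as [_ H']. symmetry; auto.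
      - rewrite (ind_false (stay_event _ _ _)) by auto. pose proof (ind_bounds (EvO l)). lra. }
  pose proof (return_ge_square p m N (t / 2) Hp1 ltac:(lra)) as H1.
  pose proof (mass_lower p m (eq Oconf) N (t / 2) Hp1 ltac:(lra)) as H2.
  replace (2 * (t / 2)) with t in H1 by field.
  assert (Hmono : tail_bound m (S N) (t / 2) <= tail_bound m (S N) t) by (apply tail_bound_mono; lra).
  assert (He : 0 <= tail_bound m (S N) t) by (apply tail_bound_nonneg; auto).
  fold C in H1, H2.
  assert (HF0 : mass p m (fun x => chi m x * ind (Oconf = x)) = 1).
  { unfold mass. rewrite (lsum_single _ _ Oconf).
    - rewrite wt_O. unfold chi. rewrite !ind_true by auto using below_O. ring.
    - apply NoDup_alls, NoDup_sites.
    - apply O_in_box.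
    - intros x Hx. rewrite (ind_false (Oconf = x)) by auto. ring. }
  rewrite HF0 in H2.
  set (U := fun x => GS p (stay_event m (eq Oconf)) (S N) [] x (t / 2)) in *.
  set (e := tail_bound m (S N) t) in *. set (e' := tail_bound m (S N) (t / 2)) in *.
  (* Expansion of [(U - / Zb) ^ 2 >= 0], summed with the weights, together with [Zbox <= Zb]. *)
  assert (HCS : 2 / Zb * mass p m U - / Zb <= mass p m (fun x => U x ^ 2)).
  { apply Rle_trans with (2 / Zb * mass p m U - / Zb ^ 2 * Zbox p m).
    - apply Rplus_le_compat_l, Ropp_le_contravar.
      replace (/ Zb) with (/ Zb ^ 2 * Zb) by (field; lra).
      apply Rmult_le_compat_l; auto. left. apply Rinv_0_lt_compat, pow_lt; auto.
    - unfold mass, Zbox. rewrite <- !lsum_scal, <- lsum_minus. apply lsum_le. intros x _.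
      pose proof (wt_pos p x Hp1). apply Rminus_le_0.
      replace (_ - _) with (wt p x * (U x - / Zb) ^ 2) by (field; lra).
      apply Rmult_le_pos; [lra|]. apply pow2_ge_0. }
  change (mass p m (fun x => U x ^ 2) - t / 2 * (C * e * Zbox p m) <=
          GS p (stay_event m (eq Oconf)) (S N) [] Oconf t) in H1.
  change (1 - t / 2 * (flux p m + C * e' * Zbox p m) <= mass p m U) in H2.
  eapply Rle_trans; [|apply H1].
  assert (H3 : 1 - t / 2 * flux p m - t / 2 * A * e <= mass p m U).
  { eapply Rle_trans; [|apply H2].
    assert (t / 2 * (A * e') <= t / 2 * (A * e))
      by (apply Rmult_le_compat_l; [lra|apply Rmult_le_compat_l; auto]).
    unfold A in *. lra. }
  assert (Hi : 0 < / Zb) by (apply Rinv_0_lt_compat; auto).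
  assert (H4 : 2 / Zb * (1 - t / 2 * flux p m - t / 2 * A * e) <= 2 / Zb * mass p m U).
  { apply Rmult_le_compat_l; auto. unfold Rdiv; lra. }
  apply Rle_trans with (2 / Zb * (1 - t / 2 * flux p m - t / 2 * A * e) - / Zb - t / 2 * (C * e * Zbox p m)).
  - right. unfold b, A. field. lra.
  - lra.
Qed.

(** * Upper bound for reaching the level [m] *)

Definition high_event (m : nat) (l : list conf) : Prop := exists x, In x l /\ (m <= area x)%nat.

(** The total loss of weighted mass up to time [t] is at most [t flux]. Every state loses a
    nonnegative amount and [Oconf] has weight 1, so the loss from [Oconf] alone obeys the same
    bound. *)
Lemma high_upper p m t : 0 < p < 1 -> (0 < m)%nat -> 0 <= t ->
  Prob p (high_event m) t <= t * flux p m.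
Proof.
  intros Hp Hm Ht. set (A := maxrate m * Zbox p m).
  apply (is_lim_seq_le (fun N => GS p (high_event m) (S N) [] Oconf t)
     (fun N => t * flux p m - - (t * A) * tail_bound m (S N) t)
      (Prob p (high_event m) t) (t * flux p m)).
  2:{ apply (is_lim_seq_incr_1 (fun N => GS p (high_event m) N [] Oconf t)). apply Prob_lim; auto. }
  2:{ apply is_lim_seq_affine. apply (is_lim_seq_incr_1 (fun N => tail_bound m N t)).
      apply tail_bound_lim. }
  intros N. pose proof (mass_lower p m (fun _ => True) N t Hp Ht) as H.
  set (U := fun x => GS p (stay_event m (fun _ => True)) (S N) [] x t) in *.
  assert (H1 : 1 - U Oconf <= mass p m (fun x => chi m x * ind True) - mass p m U).
  { unfold mass. rewrite <- lsum_minus.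
    replace (1 - U Oconf) with (wt p Oconf * (chi m Oconf * ind True) - wt p Oconf * U Oconf).
    2:{ rewrite wt_O. unfold chi. rewrite !ind_true by auto using below_O. ring. }
    apply (lsum_ge_term (box m) (fun x => wt p x * (chi m x * ind True) - wt p x * U x));
      [|apply O_in_box].
    intros x _. pose proof (wt_pos p x Hp). rewrite (ind_true True) by auto.
    pose proof (stay_sum_bounds p m (fun _ => True) (S N) x t Hp Ht). fold (U x) in H1. nra. }
  assert (H2 : GS p (high_event m) (S N) [] Oconf t + U Oconf <= 1).
  { eapply Rle_trans; [|apply (GS_le_1 p (fun _ => True) (S N) [] Oconf t); auto using fin_O].
    unfold U, GS. rewrite !sum_n_lsum, <- lsum_plus. apply lsum_le. intros n _.
    pose proof (G_linear p fin [(1, fun _ => True); (-1, high_event m);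
      (-1, stay_event m (fun _ => True))] n [] Oconf t Hp stable_fin) as H2.
    cbn [lsum fold_right fst snd] in H2.
    match type of H2 with ?P -> _ => assert (Q : P) end.
    - intros l _. rewrite (ind_true True) by auto.
      destruct (classic (high_event m l)) as [H'|H'].
      + rewrite (ind_false (stay_event _ _ _)).
        * pose proof (ind_bounds (high_event m l)). lra.
        * intros [Hc _]. destruct H' as [x [Hx1 Hx2]]. rewrite Forall_forall in Hc.
          apply Hc in Hx1. destruct Hx1. lia.
      + rewrite (ind_false (high_event m l)) by auto.
        pose proof (ind_bounds (stay_event m (fun _ => True) l)). lra.
    - specialize (H2 Q ltac:(auto) fin_O Ht). lra. }
  change (mass p m (fun x => chi m x * ind True) - t * (flux p m + maxrate m * tail_bound m (S N) t * Zbox p m)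
     <= mass p m U) in H.
  unfold A. lra.
Qed.

(** The entropy of configurations with given displacement is subexponential: any [s < 1] can
    be used in the bound. *)
Lemma flux_upper p m s : 0 < p < 1 -> 0 < s < 1 ->
  flux p (S m) <= maxrate (S m) * ((p / (1 - p) / s) ^ m * Zbound s).
Proof.
  intros Hp Hs. unfold flux. pose proof (maxrate_pos (S m)). apply Rmult_le_compat_l; [lra|].
  assert (0 < p / (1 - p)) by (apply Rdiv_lt_0_compat; lra).
  assert (Hq : 0 < (p / (1 - p) / s) ^ m) by (apply pow_lt, Rdiv_lt_0_compat; lra).
  (* At area [m] the weight equals [(p / (1 - p) / s) ^ m * s ^ m]; the indicator is then
     dropped. *)
  apply Rle_trans with ((p / (1 - p) / s) ^ m * lsum (box (S m)) (fun x => s ^ area x)).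
  - rewrite <- lsum_scal. apply lsum_le. intros x _. unfold wt.
    assert (0 < s ^ area x) by (apply pow_lt; lra).
    destruct (classic (S (area x) = S m)) as [E|E].
    + rewrite ind_true, Rmult_1_r by auto. injection E as <-.
      rewrite <- Rpow_mult_distr. right. f_equal. field. lra.
    + rewrite ind_false by auto. rewrite Rmult_0_r. apply Rmult_le_pos; lra.
  - apply Rmult_le_compat_l; [lra|]. apply partition_le; auto.
Qed.

(** * Comparison of events and asymptotics *)

Lemma is_lim_seq_lsum {A} (l : list A) (u : A -> nat -> R) (v : A -> R) :
  (forall a, In a l -> is_lim_seq (u a) (v a)) ->
  is_lim_seq (fun n => lsum l (fun a => u a n)) (lsum l v).
Proof.
  induction l as [|a l IH]; intros H; simpl; [apply is_lim_seq_const|].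
  apply is_lim_seq_plus'; [apply H; left; auto|apply IH; intros; apply H; right; auto].
Qed.

Lemma Prob_linear p (P : conf -> Prop) (cs : list (R * (list conf -> Prop))) t :
  0 < p < 1 -> stable P -> P Oconf ->
  (forall l, Forall P l -> 0 <= lsum cs (fun c => fst c * ind (snd c l))) -> 0 <= t ->
  0 <= lsum cs (fun c => fst c * Prob p (snd c) t).
Proof.
  intros Hp HP HO Hcs Ht.
  apply (is_lim_seq_le (fun _ => 0)
    (fun N => lsum cs (fun c => fst c * GS p (snd c) N [] Oconf t)) 0
    (lsum cs (fun c => fst c * Prob p (snd c) t))).
  - intros N. rewrite (lsum_ext cs _ (fun c => lsum (seq 0 (S N)) (fun n =>
       fst c * G p (snd c) n [] Oconf t))).
    + rewrite lsum_exchange. apply lsum_nonneg. intros n _. apply (G_linear p P); auto.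
    + intros c _. rewrite lsum_scal. unfold GS. rewrite sum_n_lsum. auto.
  - apply is_lim_seq_const.
  - apply is_lim_seq_lsum. intros c _.
    apply is_lim_seq_mult'; [apply is_lim_seq_const|apply Prob_lim; auto].
Qed.

(** * Running maxima and the covering of the return event *)

Lemma lmax_ge f l x : In x l -> f x <= lmax f l.
Proof.
  unfold lmax. generalize (f (hd Oconf l)) as b. intros b.
  induction l as [|a l IH]; intros Hx; [destruct Hx|]. simpl.
  destruct Hx as [->|Hx]; [apply Rmax_l|]. eapply Rle_trans; [apply IH; auto|apply Rmax_r].
Qed.

Lemma lmax_le f l b : l <> [] -> (forall x, In x l -> f x <= b) -> lmax f l <= b.
Proof.
  intros Hl H. unfold lmax.
  assert (Hd : f (hd Oconf l) <= b) by (destruct l; [tauto|apply H; left; auto]).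
  revert Hd. generalize (f (hd Oconf l)) as c. intros c Hc. clear Hl.
  induction l as [|a l IH]; simpl; auto.
  apply Rmax_lub; [apply H; left; auto|apply IH; intros; apply H; right; auto].
Qed.

Lemma lmax_le_lmax f g l : l <> [] -> (forall x, In x l -> f x <= g x) -> lmax f l <= lmax g l.
Proof.
  intros Hl H. apply lmax_le; auto. intros x Hx.
  eapply Rle_trans; [apply H; auto|apply lmax_ge; auto].
Qed.

(** The middle inequality of [EvGood] always holds since the top position is at most the area. If
    the lower bound fails, every state is low; if the upper one fails, some area exceeds [m]. *)
Lemma EvO_cover p eps t m l : Forall neutral l -> INR m <= (1 + eps) * cp p * ln t ->
  EvO l -> EvGood p eps t l \/ low_event ((1 - eps) * cp p * ln t) l \/ high_event (S m) l.
Proof.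
  intros Hn Hm HO. rewrite Forall_forall in Hn.
  destruct (classic (low_event ((1 - eps) * cp p * ln t) l)) as [|Hlow]; auto.
  destruct (classic (high_event (S m) l)) as [|Hhigh]; auto. left.
  assert (Hx : exists x, In x l /\ (1 - eps) * cp p * ln t <= IZR (Mpos x)).
  { apply NNPP; intros Hc. apply Hlow. split; auto. intros x Hx.
    apply Rnot_le_lt. intros Hx'. apply Hc. exists x; auto. }
  destruct Hx as [x [Hx1 Hx2]].
  assert (Hl : l <> []) by (intros ->; destruct Hx1).
  split; [auto|split; [|split]].
  - eapply Rle_trans; [apply Hx2|]. apply (lmax_ge (fun x => IZR (Mpos x))); auto.
  - apply lmax_le_lmax; auto. intros z Hz. rewrite Dnum_area by auto.
    rewrite INR_IZR_INZ. apply IZR_le, Mpos_le_area, neutral_fin; auto.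
  - apply lmax_le; auto. intros z Hz. rewrite Dnum_area by auto.
    eapply Rle_trans; [|apply Hm]. apply le_INR.
    destruct (Nat.le_gt_cases (area z) m); auto. exfalso. apply Hhigh. exists z; split; auto.
Qed.

Lemma Prob_EvO_le p eps t m : 0 < p < 1 -> 0 <= t -> INR m <= (1 + eps) * cp p * ln t ->
  Prob p EvO t <= Prob p (EvGood p eps t) t + Prob p (low_event ((1 - eps) * cp p * ln t)) t
     + Prob p (high_event (S m)) t.
Proof.
  intros Hp Ht Hm.
  pose proof (Prob_linear p neutral [(-1, EvO); (1, EvGood p eps t);
     (1, low_event ((1 - eps) * cp p * ln t)); (1, high_event (S m))] t Hp stable_neutral neutral_O) as H.
  cbn [lsum fold_right fst snd] in H.
  match type of H with ?P -> _ => assert (Q : P) end; [|specialize (H Q Ht); lra].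
  intros l Hl. pose proof (ind_bounds (EvGood p eps t l)).
  pose proof (ind_bounds (low_event ((1 - eps) * cp p * ln t) l)).
  pose proof (ind_bounds (high_event (S m) l)).
  destruct (classic (EvO l)) as [HO|HO].
  - rewrite (ind_true (EvO l)) by auto.
    destruct (EvO_cover p eps t m l Hl Hm HO) as [E|[E|E]]; rewrite (ind_true _ E); lra.
  - rewrite (ind_false (EvO l)) by auto. lra.
Qed.

Lemma Prob_good_le p eps t : 0 < p < 1 -> 0 <= t -> Prob p (EvGood p eps t) t <= Prob p EvO t.
Proof.
  intros Hp Ht.
  pose proof (Prob_linear p neutral [(1, EvO); (-1, EvGood p eps t)] t Hp stable_neutral neutral_O) as H.
  cbn [lsum fold_right fst snd] in H.
  match type of H with ?P -> _ => assert (Q : P) end; [|specialize (H Q Ht); lra].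
  intros l _. destruct (classic (EvGood p eps t l)) as [E|E].
  - rewrite !ind_true; auto; [lra|]. apply E.
  - rewrite (ind_false _ E). pose proof (ind_bounds (EvO l)). lra.
Qed.

(** * Asymptotics in [t] *)

Lemma pow_exp a n : exp a ^ n = exp (a * INR n).
Proof.
  induction n as [|n IH]; [simpl; rewrite Rmult_0_r, exp_0; auto|].
  rewrite S_INR. simpl. rewrite IH, <- exp_plus. f_equal. ring.
Qed.

Lemma cp_pos_log p : 0 < p < 1 / 2 ->
  exists k, 0 < k /\ cp p = / k /\ p / (1 - p) = exp (- k).
Proof.
  intros Hp. pose proof (ratio_gt_1 p Hp) as Hr.
  assert (Hk : 0 < ln ((1 - p) / p)) by (rewrite <- ln_1; apply ln_increasing; lra).
  exists (ln ((1 - p) / p)). split; [auto|split].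
  - unfold cp. rewrite Rabs_right; auto. lra.
  - rewrite exp_Ropp, exp_ln by lra. field. lra.
Qed.

(** With [J] about [(1 - eta) * cp p * ln t], the exponent [(p / (1 - p)) ^ J * t] is of order
    [exp (eta * ln t)], so the bound is far smaller than the polynomial decay recorded here. *)
Lemma low_asymptotic p eps : 0 < p < 1 / 2 -> 0 < eps ->
  exists K eta, 0 < eta /\ 0 < K /\ forall t, 1 <= t ->
    Prob p (low_event ((1 - eps) * cp p * ln t)) t <= K * exp (- eta * ln t).
Proof.
  intros Hp He. destruct (cp_pos_log p Hp) as (k & Hk & Hcp & Hr).
  destruct (rightmost_low_bound p Hp) as [C [HC Hlow]].
  (* Capping at 1 keeps the level [Y] nonnegative, so that its integer part exists; the event only
     grows. *)
  set (eta := Rmin eps 1). assert (Heta : 0 < eta <= 1) by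
    (unfold eta; split; [apply Rmin_glb_lt; lra|apply Rmin_r]).
  assert (Hee : eta <= eps) by apply Rmin_l.
  (* The factor [exp (- k)] pays for rounding [Y] up to [S n]. *)
  exists (/ (C * exp (- k))), eta.
  assert (HCk : 0 < C * exp (- k)) by (apply Rmult_lt_0_compat; auto; apply exp_pos).
  split; [lra|split; [apply Rinv_0_lt_compat; auto|]]. intros t Ht.
  assert (Hs : 0 <= ln t) by (rewrite <- ln_1; apply ln_le; lra).
  assert (Hts : t = exp (ln t)) by (rewrite exp_ln; lra).
  set (s := ln t) in *. rewrite Hcp.
  set (Y := (1 - eta) * / k * s).
  assert (Hk' : 0 < / k) by (apply Rinv_0_lt_compat; auto).
  assert (HY : 0 <= Y) by (apply Rmult_le_pos; auto; apply Rmult_le_pos; lra).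
  destruct (nfloor_ex Y HY) as [n [Hn1 Hn2]].
  apply Rle_trans with (exp (- (C * (p / (1 - p)) ^ S n) * t)).
  - apply (is_lim_seq_le (fun N => GS p (low_event ((1 - eps) * / k * s)) N [] Oconf t)
      (fun _ => exp (- (C * (p / (1 - p)) ^ S n) * t))
      (Prob p (low_event ((1 - eps) * / k * s)) t) (exp (- (C * (p / (1 - p)) ^ S n) * t))).
    + intros N. apply Hlow; [|lra]. rewrite S_INR. apply Rle_trans with Y; [|lra].
      unfold Y. apply Rmult_le_compat_r; auto. apply Rmult_le_compat_r; lra.
    + apply Prob_lim; lra.
    + apply is_lim_seq_const.
  - set (v := C * exp (- k) * exp (eta * s)).
    assert (Hv : 0 < v) by (apply Rmult_lt_0_compat; auto; apply exp_pos).
    apply Rle_trans with (exp (- v)).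
    + apply exp_monotone. rewrite Ropp_mult_distr_l_reverse. apply Ropp_le_contravar.
      unfold v. rewrite Hts, !Rmult_assoc. apply Rmult_le_compat_l; [lra|].
      rewrite Hr, pow_exp, <- !exp_plus. apply exp_monotone. fold s. rewrite S_INR.
      assert (k * Y = (1 - eta) * s) by (unfold Y; field; lra).
      assert (k * INR n <= k * Y) by (apply Rmult_le_compat_l; lra). lra.
    (* From here [exp (- v) <= / v] suffices. *)
    + rewrite (exp_Ropp v). replace (- eta * s) with (- (eta * s)) by ring.
      rewrite (exp_Ropp (eta * s)).
      rewrite <- Rinv_mult. fold v. apply Rinv_le_contravar; auto.
      pose proof (exp_ineq1_le v). lra.
Qed.

(** The powers of [t] are 1 from the factor [t], [- (1 + eps / 2)] from the weight, and [eps / 4]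
    for the number of edges, which grows only like [ln t]; they add up to [- eps / 4]. *)
Lemma flux_asymptotic p eps : 0 < p < 1 / 2 -> 0 < eps ->
  exists K eta, 0 < eta /\ 0 < K /\ forall t, 1 <= t ->
    exists m, INR m <= (1 + eps) * cp p * ln t /\ t * flux p (S m) <= K * exp (- eta * ln t).
Proof.
  intros Hp He. destruct (cp_pos_log p Hp) as (k & Hk & Hcp & Hr).
  (* Chosen so that [(1 - d) * (1 + eps) = 1 + eps / 2]; the parameter [sg] is [(p / (1 - p))] to
     the power [d]. *)
  set (d := eps / (2 * (1 + eps))).
  assert (Hd : 0 < d < 1).
  { unfold d. split; [apply Rdiv_lt_0_compat; lra|].
    apply Rmult_lt_reg_r with (2 * (1 + eps)); [lra|].
    unfold Rdiv. rewrite Rmult_assoc, Rinv_l; lra. }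
  set (sg := exp (- (d * k))).
  assert (Hdk : 0 < d * k) by (apply Rmult_lt_0_compat; lra).
  assert (Hsg : 0 < sg < 1).
  { unfold sg. split; [apply exp_pos|]. rewrite <- exp_0. apply exp_increasing. lra. }
  set (a := (1 + eps) * / k).
  assert (Hk' : 0 < / k) by (apply Rinv_0_lt_compat; auto).
  assert (Ha : 0 < a) by (apply Rmult_lt_0_compat; lra).
  assert (HZ : 0 < Zbound sg) by apply exp_pos.
  (* Comes from [s <= 4 / eps * exp (eps / 4 * s)] applied to the number of edges. *)
  set (B := 2 * (a * (4 / eps) + 2)).
  assert (H4 : 0 < 4 / eps) by (apply Rdiv_lt_0_compat; lra).
  assert (HB : 0 < B).
  { unfold B. assert (0 < a * (4 / eps)) by (apply Rmult_lt_0_compat; auto). lra. }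
  exists (B * (exp k * Zbound sg)), (eps / 4).
  split; [lra|]. split; [apply Rmult_lt_0_compat; auto; apply Rmult_lt_0_compat; auto; apply exp_pos|].
  intros t Ht.
  assert (Hs : 0 <= ln t) by (rewrite <- ln_1; apply ln_le; lra).
  assert (Hts : t = exp (ln t)) by (rewrite exp_ln; lra).
  set (s := ln t) in *. rewrite Hcp. fold a.
  destruct (nfloor_ex (a * s)) as [m [Hm1 Hm2]]; [apply Rmult_le_pos; lra|].
  exists m. split; auto.
  eapply Rle_trans; [apply Rmult_le_compat_l; [lra|apply (flux_upper p m sg); auto; lra]|].
  assert (Hmr : maxrate (S m) <= B * exp (eps / 4 * s)).
  { unfold maxrate. rewrite mult_INR, !S_INR. simpl (INR 0).
    pose proof (exp_ineq1_le (eps / 4 * s)) as He1.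
    assert (0 <= eps / 4 * s) by (apply Rmult_le_pos; lra).
    assert (Hse : s <= 4 / eps * exp (eps / 4 * s)).
    { replace s with (4 / eps * (eps / 4 * s)) at 1 by (field; lra).
      apply Rmult_le_compat_l; lra. }
    assert (a * s <= a * (4 / eps * exp (eps / 4 * s))) by (apply Rmult_le_compat_l; lra).
    unfold B. lra. }
  (* Rounding down to [m] costs a factor at most [exp k]. *)
  assert (Hpw : (p / (1 - p) / sg) ^ m <= exp k * exp (- ((1 + eps / 2) * s))).
  { rewrite Hr. unfold sg, Rdiv. rewrite <- exp_Ropp, <- exp_plus, pow_exp, <- exp_plus.
    apply exp_monotone.
    assert (E : (1 - d) * k * (a * s) = (1 + eps / 2) * s) by (unfold d, a; field; lra).
    assert (H : (1 - d) * k * (a * s - 1) <= (1 - d) * k * INR m).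
    { apply Rmult_le_compat_l; [apply Rmult_le_pos; lra|lra]. }
    lra. }
  assert (0 < (p / (1 - p) / sg) ^ m).
  { apply pow_lt. rewrite Hr. apply Rdiv_lt_0_compat; [apply exp_pos|lra]. }
  pose proof (maxrate_pos (S m)).
  apply Rle_trans with (t * (B * exp (eps / 4 * s) * (exp k * exp (- ((1 + eps / 2) * s)) * Zbound sg))).
  - apply Rmult_le_compat_l; [lra|]. apply Rmult_le_compat; try lra.
    + apply Rmult_le_pos; lra.
    + apply Rmult_le_compat_r; lra.
  - right. rewrite Hts at 1. fold s.
    replace (- (eps / 4) * s) with (s + eps / 4 * s + - ((1 + eps / 2) * s)) by field.
    rewrite !exp_plus. ring.
Qed.

Lemma is_lim_exp_neg_ln eta : 0 < eta -> is_lim (fun t => exp (- eta * ln t)) p_infty 0.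
Proof.
  intros He. apply (is_lim_comp exp (fun t => - eta * ln t) p_infty 0 m_infty).
  - apply is_lim_exp_m.
  - evar_last; [apply is_lim_scal_l, is_lim_ln_p|].
    unfold Rbar_mult, Rbar_mult'. destruct Rle_dec; [exfalso; lra|auto].
  - exists 0. intros; discriminate.
Qed.

Lemma ratio_lim (g a : R -> R) (K eta Z : R) : 0 < eta -> 0 < K -> 0 < Z ->
  (forall t, 1 <= t -> g t <= a t /\ a t - g t <= K * exp (- eta * ln t) /\
     (1 - K * exp (- eta * ln t)) / Z <= a t) ->
  is_lim (fun t => g t / a t) p_infty 1.
Proof.
  intros He HK HZ H. pose proof (is_lim_exp_neg_ln eta He) as Hlim.
  (* Once the error is at most one half, the denominator is at least [/ (2 * Z)]. *)
  assert (Hsmall : Rbar_locally' p_infty (fun t => K * exp (- eta * ln t) <= / 2)).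
  { assert (0 < / (2 * K)) by (apply Rinv_0_lt_compat; lra).
    apply is_lim_spec in Hlim. specialize (Hlim (mkposreal _ H0)). simpl in Hlim.
    destruct Hlim as [M HM]. exists M. intros t Ht. specialize (HM t Ht).
    rewrite Rminus_0_r, Rabs_right in HM by (left; apply exp_pos).
    apply Rle_trans with (K * / (2 * K)); [apply Rmult_le_compat_l; lra|].
    right. field. lra. }
  apply (is_lim_le_le_loc (fun t => 1 - 2 * Z * K * exp (- eta * ln t)) (fun _ => 1)).
  - destruct Hsmall as [M HM]. exists (Rmax M 1). intros t Ht.
    assert (M < t /\ 1 < t) as [H1 H2] by (split; eapply Rle_lt_trans; [apply Rmax_l|apply Ht|apply Rmax_r|apply Ht]).
    specialize (HM t H1). destruct (H t) as (Hga & Hd & Hl); [lra|].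
    set (e := K * exp (- eta * ln t)) in *.
    assert (Ha : / (2 * Z) <= a t).
    { eapply Rle_trans; [|apply Hl]. replace (/ (2 * Z)) with (/ 2 / Z) by (field; lra).
      apply Rmult_le_compat_r; [left; apply Rinv_0_lt_compat; lra|lra]. }
    assert (H2Z : 0 < / (2 * Z)) by (apply Rinv_0_lt_compat; lra).
    assert (Ha' : 0 < a t) by lra. split.
    + replace (2 * Z * K * exp (- eta * ln t)) with (2 * Z * e) by (unfold e; ring).
      apply Rmult_le_reg_r with (a t); auto. unfold Rdiv. rewrite (Rmult_assoc (g t)), Rinv_l by lra.
      assert (1 <= 2 * Z * a t).
      { replace 1 with (2 * Z * / (2 * Z)) by (field; lra). apply Rmult_le_compat_l; lra. }
      assert (0 < e) by (apply Rmult_lt_0_compat; auto; apply exp_pos).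
      assert (e * 1 <= e * (2 * Z * a t)) by (apply Rmult_le_compat_l; lra). lra.
    + apply Rmult_le_reg_r with (a t); auto. unfold Rdiv. rewrite Rmult_assoc, Rinv_l; lra.
  - evar_last.
    + apply is_lim_minus'; [apply is_lim_const|].
      apply (is_lim_scal_l (fun t => exp (- eta * ln t)) (2 * Z * K) p_infty 0 Hlim).
    + simpl. f_equal. ring.
  - apply is_lim_const.
Qed.

Lemma exp_neg_ln_mono a b t : a <= b -> 1 <= t -> exp (- b * ln t) <= exp (- a * ln t).
Proof.
  intros H Ht. apply exp_monotone. apply Rmult_le_compat_r; [|lra].
  rewrite <- ln_1. apply ln_le; lra.
Qed.

Lemma left_drift_limit p eps : 0 < p < 1 / 2 -> 0 < eps ->
  is_lim (fun t => Prob p (EvGood p eps t) t / Prob p EvO t) p_infty 1.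
Proof.
  intros Hp He.
  destruct (low_asymptotic p eps Hp He) as (K1 & e1 & He1 & HK1 & Hlow).
  destruct (flux_asymptotic p eps Hp He) as (K2 & e2 & He2 & HK2 & Hflux).
  apply (ratio_lim _ _ (K1 + K2) (Rmin e1 e2) (Zbound (p / (1 - p)))).
  - apply Rmin_glb_lt; auto.
  - lra.
  - apply exp_pos.
  (* The same level [S m] serves twice: for the probability of a high displacement and for the
     return probability. *)
  - intros t Ht. destruct (Hflux t Ht) as (m & Hm & Hf). specialize (Hlow t Ht).
    pose proof (exp_neg_ln_mono _ e1 t (Rmin_l e1 e2) Ht) as E1.
    pose proof (exp_neg_ln_mono _ e2 t (Rmin_r e1 e2) Ht) as E2.
    set (x := exp (- Rmin e1 e2 * ln t)) in *.
    assert (Hx : 0 < x) by apply exp_pos.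
    assert (B1 : K1 * exp (- e1 * ln t) <= K1 * x) by (apply Rmult_le_compat_l; lra).
    assert (B2 : K2 * exp (- e2 * ln t) <= K2 * x) by (apply Rmult_le_compat_l; lra).
    assert (B3 : 0 < K1 * x) by (apply Rmult_lt_0_compat; auto).
    split; [apply Prob_good_le; lra|]. split.
    + pose proof (Prob_EvO_le p eps t m ltac:(lra) ltac:(lra) Hm).
      pose proof (high_upper p (S m) t ltac:(lra) ltac:(lia) ltac:(lra)). lra.
    + eapply Rle_trans; [|apply (return_lower p (S m)); auto; try lia; lra].
      apply Rmult_le_compat_r; [left; apply Rinv_0_lt_compat, exp_pos|lra].
Qed.

Theorem theorem4p2 (p eps : R) :
  0 < p < 1 -> p <> 1 / 2 -> 0 < eps ->
  is_lim (fun t => Prob p (EvGood p eps t) t / Prob p EvO t) p_infty 1.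
Proof.
  intros Hp Hn He. destruct (Rlt_le_dec p (1 / 2)) as [Hlt|Hge].
  - apply left_drift_limit; auto; lra.
  (* For [p > 1 / 2] numerator and denominator carry the same factor [exp (- (2 p - 1) t)] relative
     to [1 - p], which cancels in the ratio. *)
  - apply (is_lim_ext_loc (fun t => Prob (1 - p) (EvGood (1 - p) eps t) t / Prob (1 - p) EvO t)).
    2: apply left_drift_limit; auto; lra.
    exists 0. intros t Ht.
    replace (EvGood (1 - p) eps t) with (EvGood p eps t)
      by (unfold EvGood; rewrite (cp_reflect p) by auto; reflexivity).
    rewrite (Prob_reflect p (EvGood p eps t)), (Prob_reflect p EvO); auto; try lra.
    + symmetry. apply Rdiv_mult_l_l. pose proof (exp_pos (- (2 * p - 1) * t)). lra.
    + intros l H; apply H.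
Qed.
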